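(* Let $K$ be a field of characteristic zero, let $n\ge 1$, let $\sigma\in\mathrm{End}_{\mathrm{Pois}}(P_{2n})$ be a Poisson endomorphism of $P_{2n}=K[x_1,\ldots,x_{2n}]$ (with its canonical Poisson structure), and let $d:=\deg(\sigma)$. Let ${}^{\sigma}P_{2n}$ be the $A_{2n}$-module obtained by twisting the $A_{2n}$-module $P_{2n}$ by the extension of $\sigma$ to the Weyl algebra $A_{2n}$ described in the context. Then: 1. The $A_{2n}$-module ${}^{\sigma}P_{2n}$ is holonomic, hence of finite length and 1-generated as an $A_{2n}$-module. 2. $l_{A_{2n}}({}^{\sigma}P_{2n})\le d^{2n}$.
   Context: $K$ is a field of characteristic zero. $P_{2n}=K[x_1,\ldots,x_{2n}]$ carries the canonical Poisson structure determined by $\{x_i,x_j\}=0$, $\{x_{n+i},x_{n+j}\}=0$, $\{x_{n+i},x_j\}=\delta_{ij}$ for all $i,j=1,\ldots,n$. $\mathrm{End}_{\mathrm{Pois}}(P_{2n})$ is the set of $K$-algebra endomorphisms $\sigma$ of $P_{2n}$ with $\sigma(\{a,b\})=\{\sigma(a),\sigma(b)\}$ for all $a,b$. For such $\sigma$ put $x_i':=\sigma(x_i)$, $i=1,\ldots,2n$; the degree is $\deg(\sigma):=\max\{\deg(x_i') : i=1,\ldots,2n\}$ (total degree). The Weyl algebra $A_{2n}=\mathcal D(P_{2n})$ is the ring of differential operators on $P_{2n}$, generated by $x_1,\ldots,x_{2n},\partial_1,\ldots,\partial_{2n}$ with $[x_i,x_j]=0$, $[\partial_i,\partial_j]=0$,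 $[\partial_i,x_j]=\delta_{ij}$, $\partial_i=\partial/\partial x_i$; $P_{2n}$ is a left $A_{2n}$-module in the natural way. Each $\sigma\in\mathrm{End}_{\mathrm{Pois}}(P_{2n})$ extends to a $K$-algebra endomorphism (also denoted $\sigma$) of $A_{2n}$ by $x_i\mapsto x_i'$, $\partial_i\mapsto\partial_i'$, where $\partial_i'$ is the $K$-derivation of $P_{2n}$ given by $$\partial_i'(\cdot)=\{x_{n+i}',\cdot\}\ \text{ for } i=1,\ldots,n,\qquad \partial_i'(\cdot)=\{-x_{i-n}',\cdot\}\ \text{ for } i=n+1,\ldots,2n.$$ For an algebra $A$, an endomorphism $\sigma$ of $A$ and an $A$-module $M$, the twisted module ${}^{\sigma}M$ is $M$ as a vector space with action $a\cdot m:=\sigma(a)m$. A finitely generated $A_{2n}$-module $M$ is called holonomic if its Gelfand–Kirillov dimension is $2n$. A module is 1-generated if it is cyclic. $l_{A_{2n}}(M)$ denotes the length of an $A_{2n}$-module $M$. *)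

(* Defs.v *)
From HB Require Import structures.
From mathcomp Require Import all_boot all_order all_algebra.
From mathcomp Require Import mpoly.
From mathcomp Require Import boolp classical_sets reals constructive_ereal ereal.
From mathcomp Require Import exp ring.

Set Implicit Arguments.
Unset Strict Implicit.
Unset Printing Implicit Defensive.

Import Order.TTheory GRing.Theory Num.Theory.
Local Open Scope ring_scope.

Section GeneralModules.
Variables (K : fieldType) (A : algType K) (M : lmodType A).
Implicit Types (S T U : {pred M}) (s v b : seq M) (a : seq A).

Definition cyclic_module := exists x : M, forall y, exists a : A, y = a *: x.

Definition finitely_generated :=
  exists s, forall y, exists c : nat -> A, y = \sum_(i < size s) c i *: s`_i.

(* T / S is a simple module: S is a maximal proper submodule of T. *)
Definition covers S T :=
  [/\ {subset S <= T}, ~ {subset T <= S} &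
      forall U, GRing.submod_closed U -> {subset S <= U} -> {subset U <= T} ->
        U =i S \/ U =i T].

Definition composition_series (l : nat) (N : nat -> {pred M}) :=
  [/\ N 0%N =i pred1 0, N l =i predT,
      forall i, (i <= l)%N -> GRing.submod_closed (N i) &
      forall i, (i < l)%N -> covers (N i) (N i.+1)].

Definition finite_length := exists l N, composition_series l N.

(* The common length of all composition series (Jordan-Hoelder); the default
   value 0 is junk, taken when finite_length fails. *)
Definition module_length : nat :=
  xget 0%N [set l | exists N, composition_series l N]%classic.

(* K acts on M through the structure map c |-> c%:A of the K-algebra A. *)
Definition klincomb (c : nat -> K) s : M := \sum_(i < size s) (c i)%:A *: s`_i.

Definition kspan s : set M := [set x | exists c, x = klincomb c s]%classic.

Definition kfree s :=
  forall c, klincomb c s = 0 -> forall i, (i < size s)%N -> c i = 0.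

(* The size of a K-basis of the subspace V; 0 is junk, taken when V has no
   finite basis, which does not happen for the spans used below. *)
Definition kdim (V : set M) : nat :=
  xget 0%N [set d | exists b, [/\ size b = d, kfree b & kspan b = V]]%classic.

(* A list of vectors spanning V^i F, where V is the span of 1 and a and F is
   the span of v. *)
Fixpoint gen_filtration a v i : seq M :=
  if i is j.+1 then
    gen_filtration a v j ++ [seq c *: w | c <- a, w <- gen_filtration a v j]
  else v.

(* inf {r in R | f(i) <= i^r for i >> 0} *)
Definition growth_degree (R : realType) (f : nat -> nat) : \bar R :=
  ereal_inf [set r%:E | r in
    [set r : R | exists N, forall i, (N <= i)%N -> (f i)%:R <= i%:R `^ r]]%classic.

(* Gelfand-Kirillov dimension: the supremum, over the finite-dimensional
   subspaces V of A containing 1 and F of M, of the growth degree of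
   i |-> dim_K (V^i F). *)
Definition gk_dim (R : realType) : \bar R :=
  ereal_sup [set growth_degree R
    (fun i => kdim (kspan (gen_filtration av.1 av.2 i)))
    | av in [set: seq A * seq M]]%classic.

End GeneralModules.

(* f is a phantom argument of the carrier: it only fixes the action. *)
Definition twisted (A B : pzRingType) (f : {rmorphism A -> B}) (M : lmodType B)
  : Type := M.

Section Twist.
Variables (A B : pzRingType) (f : {rmorphism A -> B}) (M : lmodType B).
Local Notation twisted := (twisted f M).

HB.instance Definition _ := GRing.Zmodule.on twisted.

Let act (a : A) (x : twisted) : twisted := (f a *: (x : M))%R.
Let actA a b x : act a (act b x) = act (a * b) x.
Proof. by rewrite /act scalerA rmorphM. Qed.
Let act1 x : act 1 x = x. Proof. by rewrite /act rmorph1 scale1r. Qed.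
Let actDr : right_distributive act +%R.
Proof. by move=> a x y; rewrite /act scalerDr. Qed.
Let actDl x : {morph act^~ x : a b / a + b}.
Proof. by move=> a b; rewrite /act rmorphD scalerDl. Qed.
HB.instance Definition _ :=
  GRing.Zmodule_isLmodule.Build A twisted actA act1 actDr actDl.

Lemma twistedE (a : A) (x : twisted) : a *: x = f a *: (x : M).
Proof. by []. Qed.
End Twist.

Section LinearEndomorphisms.
Variables (K : fieldType) (m : nat).
Local Notation P := {mpoly K[m]}.

Definition linend : Type := {linear P -> P}.
Identity Coercion linear_of_linend : linend >-> GRing.Linear.type.
Implicit Types f g h : linend.

Lemma linendP f g : (forall p, f p = g p) -> f = g.
Proof.
move=> e; have : (f : P -> P) = g by apply/funext.
case: f g {e} => [f [[f1] [f2]]] [g [[g1] [g2]]] /= e; subst g.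
by rewrite (Prop_irrelevance f1 g1) (Prop_irrelevance f2 g2).
Qed.

HB.instance Definition _ := gen_eqMixin linend.
HB.instance Definition _ := gen_choiceMixin linend.

Let lzero : linend := \0.
Let lone : linend := idfun.
Let ladd f g : linend := f \+ g.
Let lopp f : linend := \- f.
Let lmul f g : linend := f \o g.
Let lscale (c : K) f : linend := c \*: f.

Let laddA : associative ladd.
Proof. by move=> f g h; apply: linendP => p /=; rewrite addrA. Qed.
Let laddC : commutative ladd.
Proof. by move=> f g; apply: linendP => p /=; rewrite addrC. Qed.
Let ladd0 : left_id lzero ladd.
Proof. by move=> f; apply: linendP => p /=; rewrite add0r. Qed.
Let laddN : left_inverse lzero lopp ladd.
Proof. by move=> f; apply: linendP => p /=; rewrite addNr. Qed.
Let lmulA : associative lmul.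
Proof. by move=> f g h; apply: linendP. Qed.
Let lmul1 : left_id lone lmul.
Proof. by move=> f; apply: linendP. Qed.
Let lmulr1 : right_id lone lmul.
Proof. by move=> f; apply: linendP. Qed.
Let lmulDl : left_distributive lmul ladd.
Proof. by move=> f g h; apply: linendP. Qed.
Let lmulDr : right_distributive lmul ladd.
Proof. by move=> f g h; apply: linendP => p /=; rewrite linearD. Qed.
Let lone0 : lone != lzero.
Proof.
apply/eqP => /(congr1 (fun f : linend => f 1)) /= /eqP.
by rewrite (oner_eq0 P).
Qed.

HB.instance Definition _ := GRing.isNzRing.Build linend
  laddA laddC ladd0 laddN lmulA lmul1 lmulr1 lmulDl lmulDr lone0.

Let lscaleA a b f : lscale a (lscale b f) = lscale (a * b) f.
Proof. by apply: linendP => p /=; rewrite scalerA. Qed.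
Let lscale1 : left_id 1 lscale.
Proof. by move=> f; apply: linendP => p /=; rewrite scale1r. Qed.
Let lscaleDr : right_distributive lscale +%R.
Proof. by move=> a f g; apply: linendP => p /=; rewrite scalerDr. Qed.
Let lscaleDl f : {morph lscale^~ f : a b / a + b}.
Proof. by move=> a b; apply: linendP => p /=; rewrite scalerDl. Qed.
HB.instance Definition _ :=
  GRing.Zmodule_isLmodule.Build K linend lscaleA lscale1 lscaleDr lscaleDl.
Let lscaleAl (a : K) (f g : linend) : a *: (f * g) = (a *: f) * g.
Proof. by apply: linendP. Qed.
HB.instance Definition _ := GRing.Lmodule_isLalgebra.Build K linend lscaleAl.
Let lscaleAr (a : K) (f g : linend) : a *: (f * g) = f * (a *: g).
Proof. by apply: linendP => p /=; rewrite linearZ. Qed.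
HB.instance Definition _ := GRing.Lalgebra_isAlgebra.Build K linend lscaleAr.


Definition mul_op (p : P) : linend := p \*o idfun.
Definition der_op (i : 'I_m) : linend := mderiv i.

(* The K-subalgebra of End_K(P) generated by the multiplications by the
   variables and the partial derivatives; in characteristic 0 this is the ring
   D(P) of differential operators, i.e. the Weyl algebra on m variables. *)
Inductive diffop : linend -> Prop :=
| diffop_X i : diffop (mul_op 'X_i)
| diffop_D i : diffop (der_op i)
| diffop_1 : diffop 1
| diffop_add f g : diffop f -> diffop g -> diffop (f + g)
| diffop_scale c f : diffop f -> diffop (c *: f)
| diffop_mul f g : diffop f -> diffop g -> diffop (f * g).

Definition diffop_pred : {pred linend} := fun f => `[< diffop f >].

Fact diffop_subalg : GRing.subsemialg_closed diffop_pred.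
Proof.
have d0 : diffop 0 by rewrite -(scale0r 1); apply/diffop_scale/diffop_1.
split; [|split| |].
- by apply/asboolP; exact: diffop_1.
- by apply/asboolP.
- by move=> f g /asboolP hf /asboolP hg; apply/asboolP/diffop_add.
- by move=> c f /asboolP hf; apply/asboolP/diffop_scale.
- by move=> f g /asboolP hf /asboolP hg; apply/asboolP/diffop_mul.
Qed.
HB.instance Definition _ :=
  GRing.isSubalgClosed.Build K linend diffop_pred diffop_subalg.

Record weyl := Weyl { weyl_op :> linend; _ : weyl_op \in diffop_pred }.
HB.instance Definition _ := [isSub for weyl_op].
HB.instance Definition _ := [Choice of weyl by <:].
HB.instance Definition _ := [SubChoice_isSubAlgebra of weyl by <:].

Lemma weylP (a b : weyl) : (forall p, a p = b p) -> a = b.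
Proof. by move=> e; apply/val_inj/linendP. Qed.
Lemma weyl0E p : (0 : weyl) p = 0. Proof. by []. Qed.
Lemma weyl1E p : (1 : weyl) p = p. Proof. by []. Qed.
Lemma weylDE (f g : weyl) p : (f + g) p = f p + g p. Proof. by []. Qed.
Lemma weylNE (f : weyl) p : (- f) p = - f p. Proof. by []. Qed.
Lemma weylME (f g : weyl) p : (f * g) p = f (g p). Proof. by []. Qed.
Lemma weylZE c (f : weyl) p : (c *: f) p = c *: f p. Proof. by []. Qed.

End LinearEndomorphisms.

Lemma split_lshift m n (i : 'I_m) : split (lshift n i) = inl i.
Proof. exact: (unsplitK (inl i)). Qed.
Lemma split_rshift m n (i : 'I_n) : split (rshift m i) = inr i.
Proof. exact: (unsplitK (inr i)). Qed.

Section Generators.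
Variables (K : fieldType) (m : nat).
Local Notation P := {mpoly K[m]}.
Local Notation W := (weyl K m).
Local Notation S := {mpoly K[m + m]}.

Fact polyop_subproof (p : P) : mul_op p \in @diffop_pred K m.
Proof.
elim/mpolyind: p => [|c e p _ _ IHp].
  have -> : mul_op 0 = 0 :> linend K m by apply: linendP => q /=; rewrite mul0r.
  exact: rpred0.
have -> : mul_op (c *: 'X_[e] + p) = c *: mul_op 'X_[e] + mul_op p :> linend K m.
  by apply: linendP => q /=; rewrite mulrDl scalerAl.
apply: rpredD IHp; apply: rpredZ.
rewrite mpolyXE_id; elim/big_ind: _ => [|p1 p2 h1 h2|i _].
- have -> : mul_op 1 = 1 :> linend K m by apply: linendP => q /=; rewrite mul1r.
  exact: rpred1.
- have -> : mul_op (p1 * p2) = mul_op p1 * mul_op p2 :> linend K m.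
    by apply: linendP => q /=; rewrite mulrA.
  exact: rpredM.
elim: (e i) => [|k IH].
  have -> : mul_op ('X_i ^+ 0) = 1 :> linend K m.
    by apply: linendP => q /=; rewrite mul1r.
  exact: rpred1.
have -> : mul_op ('X_i ^+ k.+1) = mul_op 'X_i * mul_op ('X_i ^+ k) :> linend K m.
  by apply: linendP => q /=; rewrite exprS mulrA.
by apply: rpredM => //; apply/asboolP/diffop_X.
Qed.
Definition polyop (p : P) : W := Weyl (polyop_subproof p).

Fact partial_subproof i : der_op K i \in @diffop_pred K m.
Proof. by apply/asboolP/diffop_D. Qed.
Definition partial i : W := Weyl (partial_subproof i).

Lemma polyopE p q : polyop p q = p * q. Proof. by []. Qed.
Lemma partialE i q : partial i q = q^`M(i). Proof. by []. Qed.

Lemma polyop_is_linear : linear polyop.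
Proof.
move=> c p q; apply: weylP => r.
by rewrite weylDE weylZE !polyopE mulrDl scalerAl.
Qed.
HB.instance Definition _ := GRing.isLinear.Build K P W *:%R polyop polyop_is_linear.
Lemma polyop_is_monoid_morphism : monoid_morphism polyop.
Proof.
by split=> [|p q]; apply: weylP => r;
  rewrite ?weylME ?weyl1E !polyopE ?mul1r ?mulrA.
Qed.
HB.instance Definition _ :=
  GRing.isMonoidMorphism.Build P W polyop polyop_is_monoid_morphism.

Lemma weyl_ind (Q : W -> Prop) :
  (forall i, Q (polyop 'X_i)) -> (forall i, Q (partial i)) -> Q 1 ->
  (forall a b, Q a -> Q b -> Q (a + b)) -> (forall c a, Q a -> Q (c *: a)) ->
  (forall a b, Q a -> Q b -> Q (a * b)) -> forall a, Q a.
Proof.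
move=> QX QD Q1 Qadd Qscale Qmul [f fP].
have /asboolP df := fP; suff : exists2 a : W, Q a & weyl_op a = f.
  by case=> a Qa af; rewrite (_ : Weyl fP = a) //; apply/val_inj; rewrite /= af.
elim: {fP} f / df.
- by move=> i; exists (polyop 'X_i).
- by move=> i; exists (partial i).
- by exists 1.
- by move=> f g _ [a Qa <-] _ [b Qb <-]; exists (a + b) => //; apply: Qadd.
- by move=> c f _ [a Qa <-]; exists (c *: a) => //; apply: Qscale.
- by move=> f g _ [a Qa <-] _ [b Qb <-]; exists (a * b) => //; apply: Qmul.
Qed.

Definition weyl_relations (B : pzRingType) (X D : 'I_m -> B) :=
  [/\ forall i j, X i * X j = X j * X i,
      forall i j, D i * D j = D j * D i &
      forall i j, D i * X j - X j * D i = (i == j)%:R].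

Lemma weyl_relationsW : weyl_relations (fun i => polyop 'X_i) partial.
Proof.
split=> [i j|i j|i j]; apply: weylP => p.
- by rewrite !weylME !polyopE mulrCA.
- by rewrite !weylME !partialE mderiv_comm.
rewrite weylDE weylNE !weylME !polyopE !partialE mderivM addrK.
rewrite mderivX mnm1E eq_sym; case: eqP => [->|_].
  by rewrite -[X in (X - _)%MM]add0m addmK mpolyX0 scale1r mul1r.
by rewrite scale0r mul0r.
Qed.

Definition weyl_form (j k : 'I_(m + m)) : K :=
  match split j, split k with
  | inr a, inl b => (a == b)%:R
  | inl a, inr b => - (a == b)%:R
  | _, _ => 0
  end.
Local Notation w := weyl_form.

Local Notation all_ord := (index_enum 'I_(m + m)).

(* normal_form intertwines comm_gen j with the commutator by the j-th generator
   and mul_gen j with left multiplication by it (normal_form_comm,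
   normal_form_mul). *)
Definition comm_gen j (p : S) : S := \sum_k w j k *: p^`M(k).
Definition mul_gen j (p : S) : S :=
  'X_j * p + \sum_(k <- take (index j all_ord) all_ord) w j k *: p^`M(k).

Definition weyl_gen (B : Type) (X D : 'I_m -> B) (k : 'I_(m + m)) : B :=
  match split k with inl i => X i | inr i => D i end.

(* The linear map {mpoly K[m + m]} -> B sending a monomial to the ordered
   product of the generators X_1 .. X_m, D_1 .. D_m of B. For B = weyl it is
   bijective in characteristic 0, which gives the universal property weyl_lift
   of the presentation of the Weyl algebra by generators and relations. *)
Section NormalForm.
Variables (B : algType K) (X D : 'I_m -> B).
Hypothesis relXD : weyl_relations X D.
Local Notation g := (weyl_gen X D).

Definition normal_form (p : S) : B := mmap (in_alg B) g p.

Let comm j k : g j * g k = g k * g j + (w j k)%:A.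
Proof.
case: relXD => XX DD DX; rewrite /weyl_gen /weyl_form.
case: (split j) (split k) => [a|a] [b|b]; rewrite ?scale0r ?addr0 //.
  by rewrite scaleNr eq_sym scaler_nat -DX opprB addrC subrK.
by rewrite scaler_nat -DX addrC subrK.
Qed.

Let Wd r (e : 'X_{1..m + m}) : B := \prod_(k <- r) g k ^+ e k.


Let W_cons k r e : Wd (k :: r) e = g k ^+ e k * Wd r e.
Proof. by rewrite /Wd big_cons. Qed.
Let W_cat r1 r2 e : Wd (r1 ++ r2) e = Wd r1 e * Wd r2 e.
Proof. by rewrite /Wd big_cat. Qed.
Let W_sub r e k : k \notin r -> Wd r (e - U_(k))%MM = Wd r e.
Proof.
move=> kr; rewrite /Wd; apply: eq_big_seq => i ir.
rewrite mnmBE mnm1E (_ : (k == i) = false) ?subn0 //.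
by apply: contraNF kr => /eqP ->.
Qed.
Let W_add r e k : k \notin r -> Wd r (U_(k) + e)%MM = Wd r e.
Proof.
move=> kr; rewrite /Wd; apply: eq_big_seq => i ir.
rewrite mnmDE mnm1E (_ : (k == i) = false) //.
by apply: contraNF kr => /eqP ->.
Qed.

Let comm_exp j k n :
  g j * g k ^+ n = g k ^+ n * g j + (n%:R * w j k) *: g k ^+ n.-1.
Proof.
elim: n => [|n IHn]; first by rewrite mulr1 mul1r mul0r scale0r addr0.
rewrite exprS mulrA comm mulrDl -mulrA IHn mulrDr mulrA -exprS -addrA.
congr (_ + _); rewrite -scalerAl mul1r -scalerAr.
case: n {IHn} => [|n]; first by rewrite mul0r scale0r add0r expr0 mul1r.
rewrite /= -exprS -scalerDl; congr (_ *: _).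
by rewrite -[in RHS]addn1 natrD mulrDl mul1r.
Qed.

Let comm_W j r e : uniq r ->
  g j * Wd r e =
  Wd r e * g j + \sum_(k <- r) ((e k)%:R * w j k) *: Wd r (e - U_(k))%MM.
Proof.
elim: r => [|k r IHr] /=; first by rewrite /Wd !big_nil mulr1 mul1r addr0.
case/andP => kr ur; rewrite W_cons mulrA comm_exp mulrDl -mulrA IHr //.
rewrite mulrDr mulrA -addrA big_cons; congr (_ + _); rewrite addrC.
congr (_ + _).
  by rewrite -scalerAl W_cons W_sub // mnmBE mnm1E eqxx subn1.
rewrite mulr_sumr; apply: eq_big_seq => i ir.
rewrite -scalerAr W_cons mnmBE mnm1E (_ : (i == k) = false) ?subn0 //.
by apply: contraNF kr => /eqP <-.
Qed.

Local Notation before j := (take (index j all_ord) all_ord).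

Let normal_formX e : normal_form 'X_[e] = Wd all_ord e.
Proof. by rewrite /normal_form mmapX. Qed.

Lemma normal_form_is_linear : linear normal_form.
Proof.
move=> c p q; rewrite /normal_form raddfD /=; congr (_ + _).
by rewrite mmapZ mulr_algl.
Qed.
HB.instance Definition _ :=
  GRing.isLinear.Build K S B *:%R normal_form normal_form_is_linear.

Lemma normal_form_comm j p :
  g j * normal_form p - normal_form p * g j = normal_form (comm_gen j p).
Proof.
elim/mpolyind: p => [|c e p _ _ IHp].
  rewrite /comm_gen (_ : \sum_k _ = 0) ?raddf0 ?mulr0 ?mul0r ?subr0 //.
  by apply: big1 => k _; rewrite mderiv0 scaler0.
rewrite linearP /= mulrDl mulrDr opprD addrACA IHp.
have -> : comm_gen j (c *: 'X_[e] + p) = c *: comm_gen j 'X_[e] + comm_gen j p.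
  rewrite /comm_gen scaler_sumr -big_split; apply: eq_bigr => k _ /=.
  by rewrite mderivD mderivZ scalerDr !scalerA mulrC.
rewrite [RHS]linearP /=; congr (_ + _).
rewrite -scalerAl -scalerAr -scalerBr; congr (_ *: _).
rewrite normal_formX comm_W ?index_enum_uniq // addrC addKr.
rewrite /comm_gen linear_sum /=; apply: eq_bigr => k _.
by rewrite mderivX scalerA linearZ /= normal_formX mulrC.
Qed.

Lemma normal_form_mul j p : normal_form (mul_gen j p) = g j * normal_form p.
Proof.
elim/mpolyind: p => [|c e p _ _ IHp].
  rewrite /mul_gen mulr0 add0r (_ : \sum_(k <- _) _ = 0) ?raddf0 ?mulr0 //.
  by apply: big1 => k _; rewrite mderiv0 scaler0.
rewrite linearP /= mulrDr -IHp.
have -> : mul_gen j (c *: 'X_[e] + p) = c *: mul_gen j 'X_[e] + mul_gen j p.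
  rewrite /mul_gen mulrDr scalerDr -scalerAr addrACA; congr (_ + _).
  rewrite scaler_sumr -big_split; apply: eq_bigr => k _ /=.
  by rewrite mderivD mderivZ scalerDr !scalerA mulrC.
rewrite [LHS]linearP /=; congr (_ + _).
rewrite -scalerAr; congr (_ *: _).
rewrite /mul_gen linearD /= linear_sum /= -mpolyXD !normal_formX.
have jr : j \in all_ord by apply: mem_index_enum.
have ur : uniq all_ord by apply: index_enum_uniq.
have rE : all_ord = before j ++ j :: drop (index j all_ord).+1 all_ord.
  rewrite -[LHS](cat_take_drop (index j all_ord)).
  by rewrite (drop_nth j) ?index_mem // nth_index.
under eq_bigr => k _ do rewrite mderivX scalerA linearZ /= normal_formX.
move: ur; set r1 := before j in rE *; set r2 := drop _ _ in rE.
rewrite rE.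
rewrite cat_uniq /= negb_or => /and3P [u1 /andP [jr1 d12] /andP [jr2 _]].
rewrite !W_cat !W_cons [RHS]mulrA comm_W // mulrDl W_add // W_add //.
rewrite mnmDE mnm1E eqxx add1n exprS !mulrA; congr (_ + _).
rewrite !mulr_suml; apply: eq_big_seq => k kr1.
rewrite W_cat W_cons -!scalerAl -mulrA [w j k * _]mulrC; congr (_ *: _).
have kj : (k == j) = false by apply: contraNF jr1 => /eqP <-.
rewrite [Wd r2 _]W_sub ?mnmBE ?mnm1E ?kj ?subn0 //.
by apply: contra d12 => kr2; apply/hasP; exists k.
Qed.

Lemma normal_form1 : normal_form 1 = 1.
Proof. by rewrite /normal_form mmapC /= scale1r. Qed.

End NormalForm.
Section Lift.
Hypothesis charK : [pchar K] =i pred0.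
Local Notation gW := (weyl_gen (fun i => polyop 'X_i) partial).
Local Notation nfW := (normal_form (fun i => polyop 'X_i) partial).

Lemma comm_gen_dual (i : 'I_(m + m)) :
  exists j (c : K), c != 0 /\ forall p, comm_gen j p = c *: p^`M(i).
Proof.
pose j := match split i with inl a => rshift m a | inr a => lshift m a end.
pose c : K := match split i with inl _ => 1 | inr _ => - 1 end.
exists j, c; split.
  by rewrite /c; case: (split i) => _; rewrite ?oppr_eq0 oner_eq0.
move=> p; rewrite /comm_gen (bigD1 i) //= big1 ?addr0.
  congr (_ *: _); rewrite /weyl_form /j /c.
  by case: (split i) => a; rewrite ?split_lshift ?split_rshift eqxx.
move=> k ki; suff -> : weyl_form j k = 0 by rewrite scale0r.
move: ki; rewrite /weyl_form /j.
case: (split_ordP i) => a ->; case: (split_ordP k) => b ->;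
  rewrite ?split_lshift ?split_rshift // eq_shift eq_sym => /negbTE -> //.
by rewrite oppr0.
Qed.

Lemma normal_form_inj : injective nfW.
Proof.
have relW := weyl_relationsW.
suff inj0 p : nfW p = 0 -> p = 0.
  move=> p q e; apply/eqP; rewrite -subr_eq0; apply/eqP/inj0.
  by rewrite linearB /= e subrr.
have [k] := ubnP (msize p); elim: k p => // k IHk p; rewrite ltnS => pk p0.
have [->//|pn0] := eqVneq p 0.
have dp0 i : p^`M(i) = 0.
  apply: IHk.
    case: k pk => [|k] pk.
      by move: pk; rewrite leqn0 msize_poly_eq0 (negbTE pn0).
    rewrite ltnS msizeE; apply/bigmax_leqP_seq => e.
    rewrite mcoeff_msupp mcoeff_deriv => ep _.
    have : (e + U_(i))%MM \in msupp p.
      by rewrite mcoeff_msupp; apply: contraNneq ep => ->; rewrite mul0rn.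
    by move/msize_mdeg_lt/leq_trans/(_ pk); rewrite mdegD mdeg1 addn1 ltnS.
  have [j [c [c0 cE]]] := comm_gen_dual i.
  have := normal_form_comm relW j p; rewrite p0 mulr0 mul0r subr0 cE linearZ /=.
  by move/esym/eqP; rewrite scaler_eq0 (negbTE c0) => /eqP.
have pC : p = (p@_0)%:MP.
  apply/mpolyP => e; rewrite mcoeffC; case: eqP => [->|/eqP e0].
    by rewrite mulr1.
  rewrite mulr0; have [i ei] : exists i, e i != 0%N.
    apply/existsP; apply: contraNT e0; rewrite negb_exists => /forallP h.
    by apply/eqP/mnmP => i; rewrite mnm0E; move: (h i); rewrite negbK => /eqP.
  have := congr1 (mcoeff (e - U_(i))) (dp0 i).
  rewrite mcoeff_deriv mcoeff0 submK; last first.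
    by apply/mnm_lepP => l; rewrite mnm1E; case: eqP => [<-|]; rewrite ?lt0n.
  by move/eqP; rewrite -mulr_natr mulf_eq0 ((pcharf0P K).1 charK) orbF => /eqP.
move: p0; rewrite pC /normal_form mmapC /= => /eqP.
by rewrite scaler_eq0 oner_eq0 orbF => /eqP ->; rewrite mpolyC0.
Qed.

Lemma normal_form_surj (a : W) : exists p, nfW p = a.
Proof.
have relW := weyl_relationsW.
suff: forall q, exists p, nfW p = a * nfW q.
  by move/(_ 1); rewrite normal_form1 mulr1.
elim/weyl_ind: a => [i|i||a b ha hb|c a ha|a b ha hb] q.
- exists (mul_gen (lshift m i) q); rewrite normal_form_mul //.
  by rewrite /weyl_gen split_lshift.
- exists (mul_gen (rshift m i) q); rewrite normal_form_mul //.
  by rewrite /weyl_gen split_rshift.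
- by exists q; rewrite mul1r.
- have [p1 e1] := ha q; have [p2 e2] := hb q; exists (p1 + p2).
  by rewrite linearD /= e1 e2 mulrDl.
- by have [p e] := ha q; exists (c *: p); rewrite linearZ /= e scalerAl.
- by have [p e] := hb q; have [r er] := ha p; exists r; rewrite er e mulrA.
Qed.

Definition weyl_coord (a : W) : S := sval (cid (normal_form_surj a)).
Lemma weyl_coordK a : nfW (weyl_coord a) = a.
Proof. by rewrite /weyl_coord; case: cid. Qed.

Variables (B : algType K) (X D : 'I_m -> B).
Hypothesis relXD : weyl_relations X D.

Definition weyl_lift (_ : [pchar K] =i pred0) (_ : weyl_relations X D) (a : W) : B :=
  normal_form X D (weyl_coord a).
Local Notation lift := (weyl_lift charK relXD).

Lemma weyl_lift_is_linear : linear lift.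
Proof.
move=> c a b; rewrite /weyl_lift -linearP; congr normal_form.
by apply: normal_form_inj; rewrite linearP /= !weyl_coordK.
Qed.
HB.instance Definition _ :=
  GRing.isLinear.Build K W B *:%R lift weyl_lift_is_linear.

Let lift1 : lift 1 = 1.
Proof.
rewrite /weyl_lift (_ : weyl_coord 1 = 1) ?normal_form1 //.
by apply: normal_form_inj; rewrite weyl_coordK normal_form1.
Qed.
Let lift_gen j a : lift (gW j * a) = weyl_gen X D j * lift a.
Proof.
rewrite /weyl_lift -normal_form_mul //; congr normal_form.
apply: normal_form_inj; rewrite normal_form_mul; last exact: weyl_relationsW.
by rewrite !weyl_coordK.
Qed.

Lemma weyl_lift_is_monoid_morphism : monoid_morphism lift.
Proof.
split=> // a; have lg j b : lift (gW j * b) = lift (gW j) * lift b.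
  by rewrite lift_gen -[gW j]mulr1 lift_gen lift1 mulr1.
elim/weyl_ind: a => [i|i||a b ha hb|c a ha|a b ha hb] q.
- by have := lg (lshift m i) q; rewrite /weyl_gen split_lshift.
- by have := lg (rshift m i) q; rewrite /weyl_gen split_rshift.
- by rewrite lift1 !mul1r.
- by rewrite mulrDl !linearD /= ha hb mulrDl.
- by rewrite -scalerAl !linearZ /= ha scalerAl.
- by rewrite -mulrA ha hb [in RHS]ha mulrA.
Qed.
HB.instance Definition _ :=
  GRing.isMonoidMorphism.Build W B lift weyl_lift_is_monoid_morphism.

Lemma weyl_liftX i : lift (polyop 'X_i) = X i.
Proof.
have := lift_gen (lshift m i) 1.
by rewrite lift1 !mulr1 /weyl_gen split_lshift.
Qed.
Lemma weyl_liftD i : lift (partial i) = D i.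
Proof.
have := lift_gen (rshift m i) 1.
by rewrite lift1 !mulr1 /weyl_gen split_rshift.
Qed.
End Lift.
End Generators.

Section Poisson.
Variables (K : fieldType) (n : nat).
Local Notation P := {mpoly K[n + n]}.
Local Notation W := (weyl K (n + n)).
Implicit Types f g h : P.

(* With x_i = 'X_(lshift n i) and x_(n+i) = 'X_(rshift n i), this is the biderivation
   such that {x_(n+i), x_j} = (i == j), {x_i, x_j} = {x_(n+i), x_(n+j)} = 0. *)
Definition poisson f g : P :=
  \sum_(i < n) (f^`M(rshift n i) * g^`M(lshift n i)
                - f^`M(lshift n i) * g^`M(rshift n i)).

(* The derivation {f, -} of P as an element of the Weyl algebra
   (hamiltonianE). *)
Definition hamiltonian f : W :=
  \sum_(i < n) (polyop f^`M(rshift n i) * partial K (lshift n i)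
                - polyop f^`M(lshift n i) * partial K (rshift n i)).

Lemma hamiltonianE f g : hamiltonian f g = poisson f g.
Proof.
rewrite /hamiltonian /poisson.
elim/big_ind2: _ => // a b c d <- <-; exact: weylDE.
Qed.

Definition poisson_endo (sigma : P -> P) :=
  forall f g, sigma (poisson f g) = poisson (sigma f) (sigma g).

(* msize is the total degree plus one. *)
Definition endo_deg (sigma : P -> P) : nat :=
  \max_(i < n + n) (msize (sigma 'X_i)).-1.

Lemma mderivXU (i j : 'I_(n + n)) : ('X_j : P)^`M(i) = if i == j then 1 else 0.
Proof.
rewrite mderivX mnm1E eq_sym; case: eqP => [->|_]; last by rewrite scale0r.
by rewrite -[X in (X - _)%MM]add0m addmK mpolyX0 scale1r.
Qed.

Lemma poissonC f g : poisson f g = - poisson g f.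
Proof.
rewrite /poisson -sumrN; apply: eq_bigr => i _.
by rewrite opprB mulrC [X in _ - X]mulrC.
Qed.

Lemma poissonX f i : poisson f 'X_i =
  match split i with inl a => f^`M(rshift n a) | inr a => - f^`M(lshift n a) end.
Proof.
rewrite /poisson; case: (split_ordP i) => a ->; rewrite (bigD1 a) //= big1 ?addr0.
- by rewrite !mderivXU !eq_shift eqxx mulr1 mulr0 subr0 ?split_lshift.
- by move=> b ba; rewrite !mderivXU !eq_shift (negbTE ba) !mulr0 subr0.
- by rewrite !mderivXU !eq_shift eqxx mulr1 mulr0 sub0r ?split_rshift.
- by move=> b ba; rewrite !mderivXU !eq_shift (negbTE ba) !mulr0 subr0.
Qed.

Lemma poissonM f g h : poisson f (g * h) = poisson f g * h + g * poisson f h.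
Proof.
rewrite /poisson mulr_suml mulr_sumr -big_split; apply: eq_bigr => i _ /=.
by rewrite !mderivM; ring.
Qed.

Lemma poisson_deriv f g i :
  (poisson f g)^`M(i) = poisson f^`M(i) g + poisson f g^`M(i).
Proof.
rewrite /poisson linear_sum /= -big_split; apply: eq_bigr => j _ /=.
rewrite mderivB !mderivM !(mderiv_comm i); ring.
Qed.

Lemma poissonNl f g : poisson (- f) g = - poisson f g.
Proof.
rewrite /poisson -sumrN; apply: eq_bigr => i _.
by rewrite !mderivN !mulNr opprD.
Qed.

Lemma hamiltonian_polyop f g :
  hamiltonian f * polyop g - polyop g * hamiltonian f = polyop (poisson f g).
Proof.
apply: weylP => p.
by rewrite weylDE weylNE !weylME !polyopE !hamiltonianE poissonM addrK.
Qed.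


Lemma derivation_eq0 (d : {linear P -> P}) :
  (forall f g, d (f * g) = d f * g + f * d g) -> (forall i, d 'X_i = 0) ->
  forall f, d f = 0.
Proof.
move=> dM dX.
have d1 : d 1 = 0.
  by have /eqP := dM 1 1; rewrite !mulr1 mul1r -subr_eq0 opprD addNKr oppr_eq0 => /eqP.
elim/mpolyind => [|c e p _ _ IHp]; first exact: linear0.
rewrite linearP /= IHp addr0 mpolyXE_id.
rewrite (_ : d _ = 0) ?scaler0 //; elim/big_ind: _ => // [f g f0 g0|i _].
  by rewrite dM f0 g0 mul0r mulr0 addr0.
by elim: (e i) => [|k IHk] //; rewrite exprS dM dX IHk mul0r mulr0 addr0.
Qed.

Lemma hamiltonian_comm f g :
  hamiltonian f * hamiltonian g - hamiltonian g * hamiltonian f =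
  hamiltonian (poisson f g).
Proof.
apply/eqP; rewrite -subr_eq0; set d := (X in X == 0); apply/eqP/weylP => r.
rewrite weyl0E; move: r.
have dE p : d p = poisson f (poisson g p) - poisson g (poisson f p)
                  - poisson (poisson f g) p.
  by rewrite /d !weylDE !weylNE !weylME !hamiltonianE.
apply: derivation_eq0 => [p q|i].
  rewrite !dE !poissonM.
  have poissonD u v w : poisson u (v + w) = poisson u v + poisson u w.
    by rewrite -!hamiltonianE linearD.
  by rewrite !poissonD !poissonM; ring.
have poissonN u v : poisson u (- v) = - poisson u v.
  by rewrite -!hamiltonianE linearN.
rewrite dE !poissonX; case: (split i) => a; rewrite ?poissonN poisson_deriv.
  by rewrite [poisson g _]poissonC opprK; ring.
by rewrite [poisson g _]poissonC; ring.
Qed.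

Lemma hamiltonianN f : hamiltonian (- f) = - hamiltonian f.
Proof. by apply: weylP => p; rewrite weylNE !hamiltonianE poissonNl. Qed.

Lemma hamiltonianC c : hamiltonian c%:MP = 0.
Proof.
apply: weylP => p; rewrite hamiltonianE weyl0E /poisson big1 // => i _.
by rewrite !mderivC !mul0r subr0.
Qed.

Section Extension.
Hypothesis charK : [pchar K] =i pred0.
Variable sigma : {lrmorphism P -> P}.
Hypothesis sigmaP : poisson_endo sigma.

Definition ext_X (i : 'I_(n + n)) : W := polyop (sigma 'X_i).
Definition ext_D (i : 'I_(n + n)) : W :=
  match split i with
  | inl a => hamiltonian (sigma 'X_(rshift n a))
  | inr a => hamiltonian (- sigma 'X_(lshift n a))
  end.

Let dual (i : 'I_(n + n)) : P :=
  match split i with inl a => 'X_(rshift n a) | inr a => - 'X_(lshift n a) end.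
Let ext_DE i : ext_D i = hamiltonian (sigma (dual i)).
Proof. by rewrite /ext_D /dual; case: (split i) => a //; rewrite rmorphN. Qed.

Let dualX i j : poisson (dual i) 'X_j = (i == j)%:R.
Proof.
rewrite poissonX /dual; case: (split_ordP i) => a ->; case: (split_ordP j) => b ->;
  rewrite ?split_lshift ?split_rshift ?mderivN !mderivXU ?opprK !eq_shift //.
- by rewrite eq_sym; case: eqP.
- by rewrite oppr0.
- by rewrite oppr0.
- by rewrite eq_sym; case: eqP.
Qed.

Fact ext_relations : weyl_relations ext_X ext_D.
Proof.
have dualC i j : exists c, poisson (dual i) (dual j) = c%:MP.
  rewrite {2}/dual; case: (split j) => a; [exists (i == rshift n a)%:R|
    exists (- (i == lshift n a)%:R)].
    by rewrite dualX mpolyC_nat.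
  by rewrite poissonC poissonNl opprK poissonC dualX mpolyCN mpolyC_nat.
split=> [i j|i j|i j].
- by rewrite /ext_X -!rmorphM mulrC.
- apply/eqP; rewrite -subr_eq0 !ext_DE hamiltonian_comm -sigmaP.
  have [c ->] := dualC i j.
  by rewrite -[c%:MP]mulr1 mul_mpolyC linearZ /= rmorph1 -mul_mpolyC mulr1 hamiltonianC.
- by rewrite ext_DE /ext_X hamiltonian_polyop -sigmaP dualX !rmorph_nat.
Qed.

(* The extension of sigma to the Weyl algebra: the unique K-algebra endomorphism
   satisfying weyl_extX and weyl_extD. *)
Definition weyl_ext : W -> W := weyl_lift charK ext_relations.
HB.instance Definition _ := GRing.LRMorphism.on weyl_ext.

Lemma weyl_extX i : weyl_ext (polyop 'X_i) = polyop (sigma 'X_i).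
Proof. exact: weyl_liftX. Qed.
Lemma weyl_extD i : weyl_ext (partial K i) = ext_D i.
Proof. exact: weyl_liftD. Qed.
End Extension.
End Poisson.

Section WeylModules.
Variables (K : fieldType) (m : nat).

(* P as a module over the Weyl algebra, by evaluation of operators. *)
Definition polymod : Type := {mpoly K[m]}.
HB.instance Definition _ := GRing.Zmodule.on polymod.
Let act (a : weyl K m) (p : polymod) : polymod := a p.
Let actA a b x : act a (act b x) = act (a * b) x. Proof. by []. Qed.
Let act1 x : act 1 x = x. Proof. by []. Qed.
Let actDr : right_distributive act +%R.
Proof. by move=> a x y; rewrite /act linearD. Qed.
Let actDl x : {morph act^~ x : a b / a + b}. Proof. by []. Qed.
HB.instance Definition _ :=
  GRing.Zmodule_isLmodule.Build (weyl K m) polymod actA act1 actDr actDl.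

Definition holonomic (R : realType) (M : lmodType (weyl K m)) :=
  finitely_generated M /\ gk_dim M R = (m%:R)%:E.
End WeylModules.

(* Main.v *)
Require Import Defs.
From HB Require Import structures.
From mathcomp Require Import all_boot all_order all_algebra.
From mathcomp Require Import mpoly.
From mathcomp Require Import boolp classical_sets reals constructive_ereal ereal.
From mathcomp Require Import exp ring zify.

Set Implicit Arguments.
Unset Strict Implicit.
Unset Printing Implicit Defensive.

Import Order.TTheory GRing.Theory Num.Theory.
Local Open Scope ring_scope.

(* Identify the module with the polynomial ring, with its degree filtration: the
   generators of the Weyl algebra raise the degree by at most d. The key point
   is a sharp form of Bernstein's inequality: if U is a submodule and v is not in
   U, then for some m of the 2m generators (m the number of variables) the ordered
   monomials in these generators, applied to v, are linearly independent modulo U.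
   Otherwise the leading monomials of the annihilator of v modulo U leave only
   O(k^(m-1)) standard monomials of degree at most k, whereas the elements
   of degree at most k in the generators, a space of dimension of order k^(2m),
   act faithfully on the span of these.
   In a strict chain of submodules every one of the l steps thus contributes
   C(k+m,m) independent elements of degree at most dk+c, so l C(k+m,m) <= C(dk+c+m,m)
   for all k, and l <= d^m. This bounds all composition series at once, a maximal
   chain being one of them; the same counts give the Gelfand-Kirillov dimension.
   Cyclicity is Stafford's argument: every element has a nonzero annihilator,
   while no nonzero operator kills a nonzero subquotient. *)

(** * Linear dependence and counting of monomials *)

(** More rows than columns give the matrix of [C] a nonzero left kernel. *)
Lemma linear_dependence (K : fieldType) (I J : finType) (C : I -> J -> K) :
  (#|J| < #|I|)%N ->
  exists2 c : I -> K, (exists i, c i != 0) & forall j, \sum_i c i * C i j = 0.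
Proof.
move=> JI; pose A := \matrix_(i < #|I|, j < #|J|) C (enum_val i) (enum_val j).
have : kermx A != 0.
  by rewrite -mxrank_eq0 mxrank_ker subn_eq0 -ltnNge (leq_ltn_trans (rank_leq_col A)).
case/rowV0Pn => v /sub_kermxP vA /rV0Pn [i vi].
exists (fun x => v 0 (enum_rank x)); first by exists (enum_val i); rewrite enum_valK.
move=> j; have := congr1 (fun M : 'rV_#|J| => M 0 (enum_rank j)) vA.
rewrite !mxE => e; rewrite -[RHS]e (reindex_onto (@enum_val I I) enum_rank) /=; last first.
  by move=> x _; rewrite enum_rankK.
apply: eq_big => [x|x _]; first by rewrite enum_valK eqxx.
by rewrite !mxE enum_rankK enum_valK.
Qed.

Lemma card_mnm_lt (r k : nat) : #|{: 'X_{1..r < k.+1}}| = 'C(r + k, r).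
Proof.
rewrite -card_partial_ord_partitions.
have leE (x : 'X_{1..r < k.+1}) i : (x i < k.+1)%N.
  by apply: leq_ltn_trans (bmdeg x); rewrite mdegE (bigD1 i) //= leq_addr.
pose f (x : 'X_{1..r < k.+1}) : r.-tuple 'I_k.+1 := [tuple inord (x i) | i < r].
have f_inj : injective f.
  move=> x y fxy; apply/eqP; rewrite bmeqP; apply/eqP/mnmP => i.
  have := congr1 (fun t : r.-tuple 'I_k.+1 => (tnth t i : nat)) fxy.
  by rewrite !tnth_mktuple !inordK.
rewrite -(card_imset predT f_inj); apply: eq_card => t; rewrite inE.
apply/imsetP/idP => [[x _ ->]|tk].
  rewrite big_tuple -ltnS; apply: leq_ltn_trans (bmdeg x); rewrite mdegE.
  by apply: leq_sum => i _; rewrite tnth_mktuple inordK.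
pose e : 'X_{1..r} := [multinom (tnth t i : nat) | i < r].
have ek : (mdeg e < k.+1)%N.
  rewrite mdegE ltnS; apply: leq_trans tk; rewrite big_tuple.
  by apply: leq_sum => i _; rewrite mnmE.
exists (BMultinom ek) => //; apply: eq_from_tnth => i.
by apply/val_inj; rewrite tnth_mktuple /= mnmE inordK.
Qed.

Lemma ffact_bounds (r k : nat) : (k ^ r <= (r + k) ^_ r <= (r + k) ^ r)%N.
Proof.
elim: r => // r /andP[IH1 IH2].
rewrite addSn ffactSS !expnS; apply/andP; split; apply: leq_mul => //.
  by rewrite leqW ?leq_addl.
by apply: leq_trans IH2 _; case: r {IH1} => // r; rewrite leq_exp2r.
Qed.

Lemma card_mnm_lt_ge (r k : nat) : (k ^ r <= #|{: 'X_{1..r < k.+1}}| * r`!)%N.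
Proof. by rewrite card_mnm_lt bin_ffact; case/andP: (ffact_bounds r k). Qed.

Lemma card_mnm_lt_le (r k : nat) : (#|{: 'X_{1..r < k.+1}}| * r`! <= (r + k) ^ r)%N.
Proof. by rewrite card_mnm_lt bin_ffact; case/andP: (ffact_bounds r k). Qed.

Lemma polynomial_growth_lt (A c a b : nat) :
  (a < b)%N -> exists k, (A * (c * k.+1) ^ a < k.+1 ^ b)%N.
Proof.
(* With this k, k+1 exceeds A c^a, so A (c(k+1))^a < (k+1)^(a+1). *)
move=> ab; exists (A * c ^ a)%N.
rewrite expnMn mulnA; apply: leq_trans (_ : (A * c ^ a).+1 ^ a.+1 <= _)%N.
  by rewrite expnS ltn_pmul2r ?expn_gt0.
by rewrite leq_pexp2l.
Qed.

(** If l > d^r, then k^r would be at most r c (dk+c)^(r-1), which has lower degree in k. *)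
Lemma leading_coef_le (l d c r : nat) : (0 < r)%N ->
  (forall k, l * k ^ r <= (d * k + c) ^ r)%N -> (l <= d ^ r)%N.
Proof.
move=> r0 h; rewrite leqNgt; apply/negP => dl.
have binom_le a b s : (0 < s)%N -> ((a + b) ^ s <= a ^ s + s * b * (a + b) ^ s.-1)%N.
  case: s => // s _; elim: s => [|s IHs]; first by rewrite !expn1 expn0; lia.
  rewrite expnS; apply: leq_trans (leq_mul (leqnn _) IHs) _ => /=.
  rewrite [in X in (_ <= _ + X)%N](expnS (a + b)) [(a ^ s.+2)%N]expnS.
  have : (a ^ s.+1 <= (a + b) ^ s.+1)%N by rewrite leq_exp2r // leq_addr.
  rewrite (expnS (a + b) s); move: (a ^ s.+1)%N ((a + b) ^ s)%N => u v; nia.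
have r1 : (r.-1 < r)%N by rewrite prednK.
have [k] := polynomial_growth_lt (r * c) (d + c) r1.
set n := k.+1; rewrite ltnNge => /negP; apply.
have h1 := leq_trans (h n) (binom_le _ _ _ r0).
have h2 : (d ^ r * n ^ r + n ^ r <= l * n ^ r)%N by rewrite -mulSnr leq_mul2r dl orbT.
have h3 : (r * c * (d * n + c) ^ r.-1 <= r * c * ((d + c) * n) ^ r.-1)%N.
  rewrite leq_mul2l; apply/orP; right; case: (r.-1) => // s.
  by rewrite leq_exp2r // mulnDl leq_add2l leq_pmulr.
move: h1 h2 h3; rewrite (expnMn d); lia.
Qed.

(** An element of [D] is determined by the set of its exponents above c, the remaining exponents and
    the list of the large ones: 2^r, (c+1)^r and k^s choices. *)
Lemma card_thin_monomials (r k c s : nat) (D : pred 'X_{1..r < k}) :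
  (forall x, D x -> #|[pred i | c < x i]| <= s)%N ->
  (#|D| <= (2 ^ r * c.+1 ^ r) * k ^ s)%N.
Proof.
move=> Ds; have [D0|[x0 Dx0]] := set_0Vmem [set x | D x].
  by rewrite -(cardsE D) D0 cards0.
have k0 : (0 < k)%N by apply: leq_ltn_trans (bmdeg x0).
have leE (x : 'X_{1..r < k}) i : (x i < k)%N.
  by apply: leq_ltn_trans (bmdeg x); rewrite mdegE (bigD1 i) //= leq_addr.
pose T (x : 'X_{1..r < k}) := [set i : 'I_r | (c < x i)%N].
(* [inord] gives junk on [T x]; there the third component is read instead. *)
pose f (x : 'X_{1..r < k}) : {set 'I_r} * {ffun 'I_r -> 'I_c.+1} * {ffun 'I_s -> 'I_k} :=
  (T x, [ffun i => inord (x i)],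
   [ffun j : 'I_s => insubd (Ordinal k0) (nth 0%N [seq x i | i <- enum (T x)] j)]).
have f_inj : {in D &, injective f}.
  move=> x y Dx Dy [Txy /ffunP lo /ffunP hi].
  apply/eqP; rewrite bmeqP; apply/eqP/mnmP => i.
  have [iT|iT] := boolP (i \in T x); last first.
    have := congr1 val (lo i); rewrite !ffunE /= !inordK //.
      by move: iT; rewrite Txy inE -leqNgt.
    by move: iT; rewrite inE -leqNgt.
  have sz : (index i (enum (T x)) < size (enum (T x)))%N by rewrite index_mem mem_enum.
  have js : (index i (enum (T x)) < s)%N.
    by apply: leq_trans sz _; rewrite -cardE cardsE; apply: Ds.
  have := congr1 val (hi (Ordinal js)); rewrite !ffunE !val_insubd /=.
  by rewrite -Txy !(nth_map i) // nth_index ?mem_enum // !leE.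
rewrite -(card_in_imset f_inj); apply: leq_trans (max_card _) _.
by rewrite !card_prod -cardsT -powersetT card_powerset cardsT !card_ffun !card_ord.
Qed.

(** * Submodules and degrees of polynomials *)

Section Submodules.
Variables (A : pzRingType) (M : lmodType A) (U : {pred M}).
Hypothesis Usub : GRing.submod_closed U.

Lemma submod0 : 0 \in U. Proof. by case: Usub. Qed.
Lemma submodZ a x : x \in U -> a *: x \in U.
Proof. by case: Usub => U0 UP xU; rewrite -[a *: x]addr0 UP. Qed.
Lemma submodD x y : x \in U -> y \in U -> x + y \in U.
Proof. by case: Usub => U0 UP xU yU; rewrite -[x]scale1r UP. Qed.
Lemma submodB x y : x \in U -> y \in U -> x - y \in U.
Proof. by move=> xU yU; rewrite -scaleN1r submodD ?submodZ. Qed.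
Lemma submod_sum (I : Type) (r : seq I) (P : pred I) (F : I -> M) :
  (forall i, P i -> F i \in U) -> \sum_(i <- r | P i) F i \in U.
Proof. by move=> FU; elim/big_ind: _ => //; [exact: submod0|exact: submodD]. Qed.
End Submodules.

Section PolynomialSize.
Variables (K : fieldType) (r : nat).
Implicit Types p q : {mpoly K[r]}.

Lemma msize_add_le p q k : (msize p <= k -> msize q <= k -> msize (p + q) <= k)%N.
Proof. by move=> pk qk; apply: leq_trans (msizeD_le _ _) _; rewrite geq_max pk. Qed.

Lemma msize_sum_le (I : Type) (s : seq I) (P : pred I) (F : I -> {mpoly K[r]}) k :
  (forall i, P i -> msize (F i) <= k)%N -> (msize (\sum_(i <- s | P i) F i) <= k)%N.
Proof.
by move=> Fk; elim/big_ind: _ => //; [rewrite msize0|move=> p q; exact: msize_add_le].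
Qed.

Lemma msize_mul_le p q : (msize (p * q) <= msize p + (msize q).-1)%N.
Proof.
have [->|p0] := eqVneq p 0; first by rewrite mul0r msize0.
have [->|q0] := eqVneq q 0; first by rewrite mulr0 msize0.
by rewrite msizeM // -(mlead_deg q0) addnS.
Qed.

Lemma msize_mderiv i p : (msize p^`M(i) <= (msize p).-1)%N.
Proof.
rewrite msizeE; apply/bigmax_leqP_seq => e; rewrite mcoeff_msupp mcoeff_deriv => ep _.
have : (e + U_(i))%MM \in msupp p.
  by rewrite mcoeff_msupp; apply: contraNneq ep => ->; rewrite mul0rn.
by move/msize_mdeg_lt; rewrite mdegD mdeg1 addn1; lia.
Qed.

(** Differentiating by X_i multiplies the coefficient at e by e_i, which is nonzero in K unless e_i
    = 0. *)
Lemma mderiv_eq0 p : [pchar K] =i pred0 -> (forall i, p^`M(i) = 0) -> p = (p@_0)%:MP.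
Proof.
move=> charK dp0; apply/mpolyP => e; rewrite mcoeffC; case: eqP => [->|/eqP e0].
  by rewrite mulr1.
rewrite mulr0; have [i ei] : exists i, e i != 0%N.
  apply/existsP; apply: contraNT e0; rewrite negb_exists => /forallP h.
  by apply/eqP/mnmP => i; rewrite mnm0E; move: (h i); rewrite negbK => /eqP.
have := congr1 (mcoeff (e - U_(i))) (dp0 i).
rewrite mcoeff_deriv mcoeff0 submK; last first.
  by apply/mnm_lepP => l; rewrite mnm1E; case: eqP => [<-|]; rewrite ?lt0n.
by move/eqP; rewrite -mulr_natr mulf_eq0 ((pcharf0P K).1 charK) orbF => /eqP.
Qed.

Lemma mcoeff_sumX k (c : 'X_{1..r < k} -> K) (e : 'X_{1..r < k}) :
  (\sum_f c f *: 'X_[bmnm f])@_(bmnm e) = c e.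
Proof.
rewrite linear_sum (bigD1 e) //= mcoeffZ mcoeffX eqxx mulr1 big1 ?addr0 // => f fe.
by rewrite mcoeffZ mcoeffX -bmeqP (negbTE fe) mulr0.
Qed.

Lemma msize_sumX k (c : 'X_{1..r < k} -> K) :
  (msize (\sum_f c f *: 'X_[bmnm f]) <= k)%N.
Proof.
by apply: msize_sum_le => f _; rewrite (leq_trans (msizeZ_le _ _)) // msizeX bmdeg.
Qed.
End PolynomialSize.

(** * Normal forms under the Weyl relations *)

Section WeylRelations.
Variables (K : fieldType) (m : nat) (A : algType K) (X D : 'I_m -> A).
Hypothesis relXD : weyl_relations X D.
Local Notation S := {mpoly K[m + m]}.
Local Notation nf := (normal_form X D).
Implicit Types p q : S.

Lemma normal_formC c : nf c%:MP = c%:A.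
Proof. by rewrite /normal_form mmapC. Qed.

Lemma normal_formX e : nf 'X_[e] = \prod_i weyl_gen X D i ^+ e i.
Proof. by rewrite /normal_form mmapX. Qed.

Lemma msize_mul_gen j p : (msize (mul_gen j p) <= (msize p).+1)%N.
Proof.
rewrite /mul_gen; apply: msize_add_le.
  by rewrite mulrC (leq_trans (msize_mul_le _ _)) // msizeX mdeg1 addn1.
apply: msize_sum_le => k _; apply: leq_trans (msizeZ_le _ _) _.
by apply: leq_trans (msize_mderiv _ _) _; lia.
Qed.

(** Besides X_j p, [mul_gen j p] has only derivatives of p, of smaller degree, so leading monomials
    multiply as in a commutative ring. *)
Lemma mlead_mul_gen j p : p != 0 -> mlead (mul_gen j p) = (U_(j) + mlead p)%MM.
Proof.
move=> p0; rewrite /mul_gen; set q := (X in _ + X).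
have Xp : mlead ('X_j * p) = (U_(j) + mlead p)%MM.
  by rewrite mleadM ?mleadXm // -msize_poly_eq0 msizeX.
rewrite -Xp mleadDl // Xp; apply: lt_mdeg_ltmc; rewrite mdegD mdeg1 add1n.
have [->|q0] := eqVneq q 0; first by rewrite mlead0 mdeg0.
rewrite mlead_deg // mlead_deg //; apply: msize_sum_le => k _.
by apply: leq_trans (msizeZ_le _ _) (leq_trans (msize_mderiv _ _) (leq_pred _)).
Qed.

Lemma mul_gen_neq0 j p : p != 0 -> mul_gen j p != 0.
Proof.
move=> p0; apply/eqP => e0; have := mlead_mul_gen j p0; rewrite e0 mlead0.
by move/(congr1 (@mdeg _)); rewrite mdegD mdeg1 mdeg0.
Qed.

Lemma normal_formX_mul e p :
  exists2 q, nf q = nf 'X_[e] * nf p & (msize q <= mdeg e + msize p)%N.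
Proof.
rewrite normal_formX mdegE.
elim: (index_enum _) => [|j s [q qE qs]]; first by exists p; rewrite ?big_nil ?mul1r.
rewrite !big_cons; elim: (e j) => [|k [q' q'E q's]].
  by exists q; rewrite ?expr0 ?mul1r.
exists (mul_gen j q'); first by rewrite (normal_form_mul relXD) q'E exprS !mulrA.
by apply: leq_trans (msize_mul_gen _ _) _; rewrite !addSn.
Qed.

Section Action.
Hypothesis charK : [pchar K] =i pred0.
Variables (M : lmodType A) (U : {pred M}).
Hypothesis Usub : GRing.submod_closed U.
Implicit Types v x : M.

Lemma normal_form_actB p q v : nf (p - q) *: v = nf p *: v - nf q *: v.
Proof. by rewrite linearB scalerBl. Qed.

Lemma normal_form_actD p q v : nf (p + q) *: v = nf p *: v + nf q *: v.
Proof. by rewrite linearD scalerDl. Qed.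

(** [M] is a module over [A] alone, so a scalar acts through a constant normal form. *)
Lemma normal_form_actZ c p v : nf (c *: p) *: v = nf c%:MP *: (nf p *: v).
Proof. by rewrite scalerA normal_formC mulr_algl linearZ. Qed.

Lemma normal_form_act0 v : nf 0 *: v = 0.
Proof. by rewrite linear0 scale0r. Qed.

Lemma normal_form_act_sum (I : Type) (s : seq I) (P : pred I) (c : I -> K) (F : I -> S) v :
  nf (\sum_(i <- s | P i) c i *: F i) *: v =
  \sum_(i <- s | P i) nf (c i)%:MP *: (nf (F i) *: v).
Proof.
elim/big_rec2: _ => [|i y p _ <-]; first exact: normal_form_act0.
by rewrite normal_form_actD normal_form_actZ.
Qed.

Lemma submod_const_eq (c : K) x : c != 0 -> (nf c%:MP *: x \in U) = (x \in U).
Proof.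
move=> c0; apply/idP/idP => [cxU|]; last exact: submodZ.
have := submodZ Usub (nf c^-1%:MP) cxU.
by rewrite scalerA !normal_formC mulr_algl scalerA mulVf // !scale1r.
Qed.

(** Induction on the degree of p. Some generator g has as commutator with p a nonzero multiple of a
    nonzero derivative of p; if this commutator moves q v out of U, then p q v or p g q v is outside
    U. A constant p acts invertibly. *)
Lemma weyl_act_notin k p v : v \notin U -> p != 0 -> (msize p <= k.+1)%N ->
  exists2 q, (msize q <= k.+1)%N & nf p *: (nf q *: v) \notin U.
Proof.
move=> vU; elim: k p => [|k IHk] p p0 pk.
  exists 1; first by rewrite msize1.
  have := pk => /msize1_polyC pE; rewrite normal_form1 scale1r pE submod_const_eq //.
  by apply: contra_neq p0 => h; rewrite pE h mpolyC0.
have [/existsP [i dp]|] := boolP [exists i, p^`M(i) != 0]; last first.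
  rewrite negb_exists => /forallP dp0.
  have pE := mderiv_eq0 charK (fun i => eqP (negPn (dp0 i))).
  exists 1; first by rewrite msize1.
  rewrite normal_form1 scale1r pE submod_const_eq //.
  by apply: contra_neq p0 => h; rewrite pE h mpolyC0.
have [j [c [c0 cE]]] := comm_gen_dual K i.
have [||q qk] := IHk (comm_gen j p).
- by rewrite cE scaler_eq0 negb_or c0.
- rewrite cE; apply: leq_trans (msizeZ_le _ _) (leq_trans (msize_mderiv _ _) _).
  by rewrite -subn1 leq_subLR.
rewrite -(normal_form_comm relXD) scalerBl -!scalerA => cU.
have [h1|h1] := boolP (nf p *: (nf q *: v) \in U); last by exists q; first exact: leqW.
exists (mul_gen j q); first by apply: leq_trans (msize_mul_gen _ _) _.
apply: contra cU => h2; apply: (submodB Usub (submodZ Usub _ h1)).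
by move: h2; rewrite (normal_form_mul relXD) -scalerA.
Qed.
End Action.
End WeylRelations.

(** * Free directions: the sharp form of Bernstein's inequality *)

Section EmbedMonomials.
Variables (r s : nat) (f : 'I_r -> 'I_s).

(** Substitution of X_(f j) for X_j; summing over the fibres of f keeps the total degree. *)
Definition embed_mnm (e : 'X_{1..r}) : 'X_{1..s} :=
  [multinom (\sum_(j | f j == i) e j)%N | i < s].

Lemma mdeg_embed_mnm e : mdeg (embed_mnm e) = mdeg e.
Proof.
rewrite !mdegE (partition_big f xpredT) //=.
by apply: eq_bigr => i _; rewrite mnmE.
Qed.

Lemma embed_mnm_out e i : i \notin codom f -> embed_mnm e i = 0%N.
Proof.
move=> fi; rewrite mnmE big_pred0 // => j; apply: contraNF fi => /eqP <-.
exact: codom_f.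
Qed.

Hypothesis f_inj : injective f.

Lemma embed_mnmE e j : embed_mnm e (f j) = e j.
Proof. by rewrite mnmE (big_pred1 j) // => i; rewrite /= (inj_eq f_inj). Qed.

Lemma embed_mnm_inj : injective embed_mnm.
Proof. by move=> e1 e2 e12; apply/mnmP => j; rewrite -!embed_mnmE e12. Qed.
End EmbedMonomials.

Section FreeDirections.
Variables (K : fieldType) (m : nat) (A : algType K) (X D : 'I_m -> A).
Hypotheses (charK : [pchar K] =i pred0) (relXD : weyl_relations X D).
Local Notation S := {mpoly K[m + m]}.
Variables (M : lmodType A) (U : {pred M}).
Hypothesis Usub : GRing.submod_closed U.
Variable v : M.
Local Notation nf := (normal_form X D).

(* The monomials [X_e] with [E e], i.e. those outside the ideal of leading
   monomials of the annihilator of [v] modulo [U], span modulo the annihilator. *)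
Lemma standard_reduction (E : pred 'X_{1..m + m}) :
  (forall e, ~~ E e -> exists r, [/\ r != 0, mlead r = e & nf r *: v \in U]) ->
  forall q : S, exists q' : S, [/\ nf (q - q') *: v \in U, {subset msupp q' <= E}
                             & (msize q' <= msize q)%N].
Proof.
move=> EU; have U0 := submod0 Usub.
elim/mleadrect => q IHq; have [->|q0] := eqVneq q 0.
  by exists 0; rewrite subrr normal_form_act0 msupp0.
(* [r] has the leading monomial of [q] and reduces to [r']: to itself if that monomial is standard,
   to 0 if it leads an annihilating element. *)
have [r [r0 rq [r' [r'q r'D rr']]]] : exists r, [/\ r != 0, mlead r = mlead q &
    exists r', [/\ (msize r' <= msize q)%N, {subset msupp r' <= E} & nf (r - r') *: v \in U]].
  have [De|/EU [r [r0 rq rU]]] := boolP (E (mlead q)).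
    exists 'X_[mlead q]; rewrite mleadXm -msize_poly_eq0 msizeX; split => //.
    exists 'X_[mlead q]; rewrite subrr normal_form_act0 msizeX mlead_deg //; split => //.
    by move=> e; rewrite msuppX inE => /eqP ->.
  by exists r; split => //; exists 0; rewrite msize0 subr0 msupp0.
pose c := q@_(mlead q) / r@_(mlead q); pose q1 := q - c *: r.
have rc : r@_(mlead q) != 0 by rewrite -rq mleadc_eq0.
have c0 : c != 0 by rewrite mulf_neq0 ?invr_eq0 // mleadc_eq0.
have q1e : q1@_(mlead q) = 0 by rewrite mcoeffB mcoeffZ divfK // subrr.
have rs : msize r = msize q by rewrite -!mlead_deg // rq.
have q1s : (msize q1 <= msize q)%N.
  by rewrite msize_add_le ?msizeN // (leq_trans (msizeZ_le _ _)) ?rs.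
have [q1' [q1U q1D q1s']] : exists q1', [/\ nf (q1 - q1') *: v \in U,
    {subset msupp q1' <= E} & (msize q1' <= msize q1)%N].
  (* The zero polynomial has leading exponent 0, which need not be below that of [q]. *)
  have [->|q10] := eqVneq q1 0.
    by exists 0; rewrite subrr normal_form_act0 msupp0.
  apply: IHq; rewrite lt_neqAle; apply/andP; split.
    by apply: contra_neq q10 => e1; apply/eqP; rewrite -mleadc_eq0 e1 q1e.
  apply: le_trans (mleadB_le _ _) _; rewrite leUx lexx /=.
  by rewrite (le_trans (mleadZ_le _ _)) // rq.
exists (c *: r' + q1'); split; last first.
- by rewrite msize_add_le ?(leq_trans q1s') // (leq_trans (msizeZ_le _ _)).
- move=> e /msuppD_le; rewrite mem_cat => /orP[/msuppZ_le /r'D|/q1D] //.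
rewrite (_ : q - _ = c *: (r - r') + (q1 - q1')); last first.
  by rewrite scalerBr /q1; ring.
rewrite normal_form_actD normal_form_actZ.
exact (submodD Usub (submodZ Usub _ rr') q1U).
Qed.

(** Otherwise the vectors X_e X_f v, with X_f standard and both degrees at most k, reduced to
    standard form of degree at most 2k, satisfy one linear relation in e common to all f. Its
    coefficients give a nonzero p sending q v into U for all q of degree at most k, against
    [weyl_act_notin]. *)
Lemma standard_dimension (E : pred 'X_{1..m + m}) (k : nat) :
  v \notin U ->
  (forall q : S, exists q' : S, [/\ nf (q - q') *: v \in U, {subset msupp q' <= E}
                             & (msize q' <= msize q)%N]) ->
  (#|{: 'X_{1..(m + m) < k.+1}}| <=
   #|[pred x : 'X_{1..(m + m) < k.+1} | E x]| *
   #|[pred x : 'X_{1..(m + m) < (k + k).+1} | E x]|)%N.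
Proof.
move=> vU red; rewrite leqNgt; apply/negP.
set Dk := [pred x : 'X_{1..(m + m) < k.+1} | E x].
set D2k := [pred x : 'X_{1..(m + m) < (k + k).+1} | E x].
have redX (e f : 'X_{1..(m + m) < k.+1}) : exists q',
    [/\ nf 'X_[e] *: (nf 'X_[f] *: v) - nf q' *: v \in U,
        {subset msupp q' <= E} & (msize q' <= (k + k).+1)%N].
  have [q qE qs] := normal_formX_mul relXD e 'X_[K, f].
  have [q' [q'U q'D q's]] := red q; exists q'; split => //.
    by rewrite scalerA -qE -normal_form_actB.
  rewrite (leq_trans q's) // (leq_trans qs) // msizeX addnS ltnS.
  by rewrite leq_add // -ltnS bmdeg.
pose Q e f := sval (cid (redX e f)).
have QP (e f : 'X_{1..(m + m) < k.+1}) :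
  [/\ nf 'X_[e] *: (nf 'X_[f] *: v) - nf (Q e f) *: v \in U,
    {subset msupp (Q e f) <= E} & (msize (Q e f) <= (k + k).+1)%N].
  by rewrite /Q; case: cid.
move=> lt_card.
have : (#|{: {x | Dk x} * {x | D2k x}}| < #|{: 'X_{1..(m + m) < k.+1}}|)%N.
  by rewrite card_prod !card_sig.
case/(linear_dependence
  (fun e (x : {x | Dk x} * {x | D2k x}) => (Q e (val x.1))@_(val x.2))) => c [e0 ce0] cQ.
pose p : S := \sum_(e : 'X_{1..(m + m) < k.+1}) c e *: 'X_[bmnm e].
have p0 : p != 0.
  by apply: contra_neq ce0 => p0; rewrite -(mcoeff_sumX c e0) -/p p0 mcoeff0.
have ps : (msize p <= k.+1)%N by exact: msize_sumX.
have pX (f : {x | Dk x}) : nf p *: (nf 'X_[val f] *: v) \in U.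
  rewrite normal_form_act_sum.
  have Q0 : \sum_e c e *: Q e (val f) = 0.
    apply/mpolyP => e'; rewrite mcoeff0 linear_sum /=.
    have [De|De] := boolP (E e'); last first.
      apply: big1 => e _; rewrite mcoeffZ memN_msupp_eq0 ?mulr0 //.
      by apply: contra De; case: (QP e (val f)) => _ QD _; exact: QD.
    have [se|se] := ltnP (mdeg e') (k + k).+1; last first.
      apply: big1 => e _; rewrite mcoeffZ memN_msupp_eq0 ?mulr0 //.
      by apply: msize_mdeg_ge; apply: leq_trans se; case: (QP e (val f)).
    have De' : D2k (BMultinom se) by [].
    rewrite -[RHS](cQ (f, exist _ (BMultinom se) De')).
    by apply: eq_bigr => e _; rewrite mcoeffZ.
  have -> : \sum_e nf (c e)%:MP *: (nf 'X_[bmnm e] *: (nf 'X_[val f] *: v)) =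
      \sum_e nf (c e)%:MP *: (nf 'X_[bmnm e] *: (nf 'X_[val f] *: v) - nf (Q e (val f)) *: v)
      + nf (\sum_e c e *: Q e (val f)) *: v.
    rewrite normal_form_act_sum -big_split; apply: eq_bigr => e _ /=.
    by rewrite -scalerDr subrK.
  rewrite Q0 normal_form_act0 addr0; apply: (submod_sum Usub) => e _.
  by case: (QP e (val f)) => h _ _; exact (submodZ Usub _ h).
have [q qs] := weyl_act_notin relXD charK Usub vU p0 ps; apply/negP; rewrite negbK.
(* Modulo U, q v is q' v, and [pX] applies to each monomial of q'. *)
have [q' [q'U q'D q's]] := red q.
have -> : nf q *: v = nf (q - q') *: v + nf q' *: v by rewrite -normal_form_actD subrK.
rewrite scalerDr; apply: submodD => //; first exact: submodZ.
rewrite {1}[q']mpolyE big_seq [X in nf p *: X]normal_form_act_sum scaler_sumr.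
apply: (submod_sum Usub) => e eq'.
have es : (mdeg e < k.+1)%N.
  by apply: leq_trans (msize_mdeg_lt eq') _; apply: leq_trans qs.
have De : Dk (BMultinom es) by exact: q'D.
rewrite scalerA normal_formC mulr_algr -mulr_algl -scalerA; apply: (submodZ Usub).
exact: (pX (exist _ (BMultinom es) De)).
Qed.

(** Multiplying by a generator keeps the image of v in U and adds one to an exponent of the leading
    monomial: the leading monomials of the annihilator modulo U form an ideal. *)
Lemma annihilator_mlead_add p e : p != 0 -> nf p *: v \in U ->
  exists r, [/\ r != 0, mlead r = (e + mlead p)%MM & nf r *: v \in U].
Proof.
move=> p0 pU.
have [d] := ubnP (mdeg e); elim: d e => // d IHd e; rewrite ltnS => ed.
have [/existsP [j ej]|] := boolP [exists j, e j != 0%N]; last first.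
  rewrite negb_exists => /forallP e0; exists p; split => //.
  suff -> : e = 0%MM by rewrite add0m.
  by apply/mnmP => j; rewrite mnm0E; apply/eqP; rewrite -[_ == _]negbK.
have eE : e = (U_(j) + (e - U_(j)))%MM.
  rewrite addmC submK //; apply/mnm_lepP => i; rewrite mnm1E.
  by case: eqP => [<-|]; rewrite ?lt0n.
have [|r [r0 rl rU]] := IHd (e - U_(j))%MM.
  by rewrite {1}eE mdegD mdeg1 add1n in ed.
exists (mul_gen j r); split; first exact: mul_gen_neq0.
  by rewrite mlead_mul_gen // rl {2}eE addmA.
by rewrite (normal_form_mul relXD) -scalerA; exact: submodZ.
Qed.

(* A combinatorial form of Bernstein's inequality: otherwise each [T] of size
   [m] gives a leading monomial of the annihilator supported on [T], hence a
   standard monomial has fewer than [m] large exponents, and there are too few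
   of them for standard_dimension. *)
Lemma free_directions : (0 < m)%N -> v \notin U ->
  exists2 T : {set 'I_(m + m)}, #|T| = m &
    forall p, (forall e i, e \in msupp p -> i \notin T -> e i = 0%N) ->
      nf p *: v \in U -> p = 0.
Proof.
move=> m0 vU; apply: contrapT => noT.
(* Stated for all T so as to give a choice function; for sets of size other than m the polynomial is
   junk. *)
have rel (T : {set 'I_(m + m)}) : exists p : S, #|T| = m ->
    [/\ p != 0, nf p *: v \in U & forall i, i \notin T -> mlead p i = 0%N].
  have [Tm|Tm] := eqVneq #|T| m; last by exists 0 => /eqP; rewrite (negbTE Tm).
  apply: contrapT => nop; apply: noT; exists T => // p pT pU.
  apply: contrapT => /eqP p0; apply: nop; exists p => _; split => // i iT.
  by apply: pT iT; apply: mlead_supp.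
pose u T := mlead (sval (cid (rel T))).
pose c := (\max_T \max_i u T i)%N.
pose E : pred 'X_{1..m + m} := fun e => ~~ [exists T : {set _}, (#|T| == m) && (u T <= e)%MM].
have ET e : ~~ E e -> exists r, [/\ r != 0, mlead r = e & nf r *: v \in U].
  rewrite negbK => /existsP [T /andP [/eqP Tm ue]].
  have [p0 pU _] := svalP (cid (rel T)) Tm.
  have [r [r0 rl rU]] := annihilator_mlead_add (e - u T)%MM p0 pU.
  by exists r; split => //; rewrite rl submK.
(* If m exponents of e exceed c, let T consist of m of them: [u T] lives on T with exponents at most
   c, so it divides X_e. *)
have thin e : E e -> (#|[pred i | c < e i]| <= m.-1)%N.
  move=> Ee; rewrite -ltnS prednK // ltnNge; apply: contra Ee => mc.
  pose s := take m (enum [pred i | (c < e i)%N]).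
  have Tm : #|[set i in s]| == m.
    by rewrite cardsE (card_uniqP _) ?take_uniq ?enum_uniq // size_takel // -cardE.
  apply/existsP; exists [set i in s]; rewrite Tm; apply/mnm_lepP => i.
  have [is_|is_] := boolP (i \in [set i in s]); last first.
    by have [_ _ ->] := svalP (cid (rel [set i in s])) (eqP Tm).
  have : (c < e i)%N.
    by move: is_; rewrite inE => /mem_take; rewrite mem_enum.
  move/ltnW/(leq_trans _); apply; rewrite /c.
  by apply: leq_trans (leq_bigmax (F := fun T => \max_i u T i)%N _); apply: leq_bigmax.
pose a := (2 ^ (m + m) * c.+1 ^ (m + m))%N.
have cardE k : (#|[pred x : 'X_{1..(m + m) < k} | E x]| <= a * k ^ m.-1)%N.
  by apply: card_thin_monomials => x; apply: thin.
have lt_exp : (m.-1 + m.-1 < m + m)%N by lia.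
(* The factor 3 covers the two degree bounds k1 + 1 and 2 k1 + 1. *)
have [k] := polynomial_growth_lt (a * a * (m + m)`!) 3 lt_exp.
rewrite ltnNge => /negP; apply; set k1 := k.+1.
apply: leq_trans (card_mnm_lt_ge (m + m) k1) _.
rewrite [X in (_ <= X)%N]mulnAC leq_mul2r; apply/orP; right.
apply: leq_trans (standard_dimension k1 vU (standard_reduction ET)) _.
apply: leq_trans (leq_mul (cardE _) (cardE _)) _.
rewrite mulnACA leq_mul2l expnD; apply/orP; right.
have le_exp b : (b <= 3 * k1)%N -> (b ^ m.-1 <= (3 * k1) ^ m.-1)%N.
  by case: (m.-1) => // s; rewrite leq_exp2r.
by apply: leq_mul; apply: le_exp; rewrite /k1; lia.
Qed.

(** Coordinates for [free_directions]: an enumeration of T turns freeness into linear independence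
    of monomials in m variables. *)
Lemma free_embedding : (0 < m)%N -> v \notin U ->
  exists2 f : 'I_m -> 'I_(m + m), injective f &
    forall k (c : 'X_{1..m < k} -> K),
      nf (\sum_e c e *: 'X_[embed_mnm f e]) *: v \in U -> forall e, c e = 0.
Proof.
move=> m0 /(free_directions m0) [T Tm freeT].
pose f (j : 'I_m) := enum_val (cast_ord (esym Tm) j).
have f_inj : injective f by move=> i j /enum_val_inj /cast_ord_inj.
exists f => // k c cU e0; pose p : S := \sum_e c e *: 'X_[embed_mnm f e].
have : p = 0.
  apply: freeT cU => e i /msupp_sum_le /flattenP [_ /mapP[x _ ->]].
  move/msuppZ_le; rewrite msuppX inE => /eqP -> iT; apply: embed_mnm_out.
  by apply: contra iT => /codomP [j ->]; exact: enum_valP.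
move/(congr1 (mcoeff (embed_mnm f e0))); rewrite linear_sum mcoeff0 (bigD1 e0) //=.
rewrite mcoeffZ mcoeffX eqxx mulr1 big1 ?addr0 // => e ee0.
rewrite mcoeffZ mcoeffX (inj_eq (embed_mnm_inj f_inj)) -bmeqP.
by rewrite (negbTE ee0) mulr0.
Qed.
End FreeDirections.

(** * Filtered modules: annihilators and strict chains *)

(* [phi] embeds [M] in a polynomial ring so that the generators of the algebra
   raise the degree by at most [d]: this is the filtration bounding the length. *)
Section FilteredModule.
Variables (K : fieldType) (m d : nat) (A : algType K) (X D : 'I_m -> A).
Hypotheses (charK : [pchar K] =i pred0) (relXD : weyl_relations X D) (m_gt0 : (0 < m)%N).
Variables (M : lmodType A) (phi : {additive M -> {mpoly K[m]}}).
Hypotheses (phi_inj : injective phi) (phiZ : forall (c : K) x, phi (c%:A *: x) = c *: phi x).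
Hypothesis phi_gen : forall j x, (msize (phi (weyl_gen X D j *: x)) <= msize (phi x) + d)%N.
Local Notation S := {mpoly K[m + m]}.
Local Notation nf := (normal_form X D).
Local Notation sz x := (msize (phi x)).

Lemma size_act_monomial e x : (sz (nf 'X_[e] *: x) <= sz x + d * mdeg e)%N.
Proof.
rewrite normal_formX mdegE; elim: (index_enum _) => [|j s IHs].
  by rewrite !big_nil scale1r muln0 addn0.
rewrite !big_cons; elim: (e j) => [|k IHk]; first by rewrite expr0 mul1r add0n.
rewrite exprS -mulrA -scalerA; apply: leq_trans (phi_gen _ _) _.
by move: IHk; rewrite addSn mulnS; lia.
Qed.

Lemma module_dependence (I : finType) (F : I -> M) N :
  (forall i, sz (F i) <= N.+1)%N -> (#|{: 'X_{1..m < N.+1}}| < #|I|)%N ->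
  exists2 c : I -> K, (exists i, c i != 0) & \sum_i (c i)%:A *: F i = 0.
Proof.
move=> FN /(linear_dependence (fun i (e : 'X_{1..m < N.+1}) => (phi (F i))@_(bmnm e))).
case=> c c0 cF; exists c => //; apply: phi_inj; rewrite raddf0 raddf_sum.
apply/mpolyP => e; rewrite mcoeff0 linear_sum /=.
have [eN|eN] := ltnP (mdeg e) N.+1; last first.
  apply: big1 => i _; rewrite phiZ mcoeffZ memN_msupp_eq0 ?mulr0 //.
  by apply: msize_mdeg_ge; apply: leq_trans eN.
rewrite -[RHS](cF (BMultinom eN)); apply: eq_bigr => i _.
by rewrite phiZ mcoeffZ.
Qed.

(** The monomials of degree at most k in the 2m generators number about k^(2m), but they send u to
    polynomials of degree O(k), a space of dimension O(k^m). *)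
Lemma exists_annihilator (u : M) : exists2 p : S, p != 0 & nf p *: u = 0.
Proof.
(* Chosen so that m + sz u + d k is at most c k for positive k. *)
pose c := (m + sz u + d)%N.
have [k] : exists k, ((m + m)`! * (c * k.+1) ^ m < k.+1 ^ (m + m))%N.
  by apply: polynomial_growth_lt; lia.
set k1 := k.+1 => lt_k.
have lt_card : (#|{: 'X_{1..m < (sz u + d * k1).+1}}| < #|{: 'X_{1..(m + m) < k1.+1}}|)%N.
  rewrite -(ltn_pmul2r (fact_gt0 (m + m))).
  apply: leq_trans (card_mnm_lt_ge (m + m) k1); apply: leq_ltn_trans lt_k.
  rewrite mulnC leq_mul2l; apply/orP; right.
  apply: leq_trans (leq_pmulr _ (fact_gt0 m)) (leq_trans (card_mnm_lt_le _ _) _).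
  by rewrite leq_exp2r // /c !mulnDl addnA !leq_add2r leq_add // leq_pmulr.
have [e|x [e0 xe0] x0] := module_dependence (F := fun e : 'X_{1..(m + m) < k1.+1} =>
  nf 'X_[bmnm e] *: u) _ lt_card.
  apply: leq_trans (size_act_monomial _ _) _; apply: leqW.
  by rewrite leq_add2l leq_mul2l -ltnS bmdeg orbT.
exists (\sum_e x e *: 'X_[bmnm e]).
  by apply: contra_neq xe0 => p0; rewrite -(mcoeff_sumX x e0) p0 mcoeff0.
by rewrite normal_form_act_sum -[RHS]x0; apply: eq_bigr => e _; rewrite normal_formC.
Qed.

Definition strict_chain (l : nat) (N : nat -> {pred M}) :=
  (forall i, (i <= l)%N -> GRing.submod_closed (N i)) /\
  (forall i, (i < l)%N -> {subset N i <= N i.+1} /\ ~ {subset N i.+1 <= N i}).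

Lemma strict_chain_mono l N : strict_chain l N ->
  forall i j, (i <= j <= l)%N -> {subset N i <= N j}.
Proof.
case=> _ strictN i j /andP[ij jl]; elim: j ij jl => [|j IHj].
  by rewrite leqn0 => /eqP -> _ x.
rewrite leq_eqVlt => /predU1P [-> _ x //|ij] jl x xi.
by case: (strictN _ jl) => sub _; apply/sub/IHj => //; rewrite ltnW.
Qed.

(* The submodules generated by vectors taken in the successive differences
   contribute each a free direction, and these are independent in [M]. *)
Lemma strict_chain_length l N : strict_chain l N -> (l <= d ^ m)%N.
Proof.
move=> chainN; have [subN strictN] := chainN.
have ex_v (i : 'I_l) : exists v, v \in N i.+1 /\ v \notin N i.
  apply: contrapT => nov; case: (strictN _ (ltn_ord i)) => _; apply => x xN.
  by apply: contrapT => xi; apply: nov; exists x; split => //; apply/negP.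
pose v i := sval (cid (ex_v i)).
have vN i : v i \in N i.+1 by rewrite /v; case: cid => ? [].
have vN' i : v i \notin N i by rewrite /v; case: cid => ? [].
have ex_f (i : 'I_l) := free_embedding charK relXD (subN i (ltnW (ltn_ord i))) m_gt0 (vN' i).
pose f i := s2val (cid2 (ex_f i)).
have f_free i : forall k (c : 'X_{1..m < k} -> K),
    nf (\sum_e c e *: 'X_[embed_mnm (f i) e]) *: v i \in N i -> forall e, c e = 0.
  by rewrite /f; case: cid2 => f' f'_inj h /=.
pose c := (\max_i sz (v i))%N.
(* Monomials of degree at most k send each [v i] to size at most c + d k; the extra m comes from
   [card_mnm_lt_le]. *)
apply: (@leading_coef_le _ _ (m + c) _ m_gt0) => k.
have card_le : (l * #|{: 'X_{1..m < k.+1}}| <= #|{: 'X_{1..m < (c + d * k).+1}}|)%N.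
  rewrite leqNgt; apply/negP; rewrite -[l]card_ord -card_prod => lt_card.
  pose F (x : 'I_l * 'X_{1..m < k.+1}) := nf 'X_[embed_mnm (f x.1) x.2] *: v x.1.
  have [x|b [x0 bx0] bF] := module_dependence (F := F) _ lt_card.
    apply: leq_trans (size_act_monomial _ _) _; apply: leqW.
    rewrite mdeg_embed_mnm leq_add ?(leq_bigmax (F := fun i => sz (v i))) //.
    by rewrite leq_mul2l -ltnS bmdeg orbT.
  pose w i := nf (\sum_e b (i, e) *: 'X_[embed_mnm (f i) e]) *: v i.
  have w_sum : \sum_i w i = 0.
    rewrite -[RHS]bF (eq_bigr (fun x => (b (x.1, x.2))%:A *: F (x.1, x.2))); last by case.
    rewrite -(pair_bigA _ (fun i e => (b (i, e))%:A *: F (i, e))).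
    apply: eq_bigr => i _; rewrite /w normal_form_act_sum.
    by apply: eq_bigr => e _; rewrite normal_formC.
  have b0 : [exists e, b (x0.1, e) != 0].
    by apply/existsP; exists x0.2; rewrite -surjective_pairing.
  (* At the largest index with a nonzero coefficient the relation puts [w i0] in [N i0]: later terms
     vanish, and earlier ones lie in [N i0] because [v i] is in [N i.+1]. *)
  pose i0 := [arg max_(i > x0.1 | [exists e, b (i, e) != 0]) (i : nat)].
  have [/existsP [e be] i0_max] : [exists e, b (i0, e) != 0] /\
      forall i, [exists e, b (i, e) != 0] -> (i <= i0)%N.
    by rewrite /i0; case: arg_maxnP.
  case/negP: be; apply/eqP; apply: (f_free i0 _ (fun e => b (i0, e))).
  rewrite -/(w i0).
  have -> : w i0 = - \sum_(i | i != i0) w i.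
    by apply/eqP; rewrite -addr_eq0 -(bigD1 i0 (P := xpredT)) //= w_sum.
  rewrite -scaleN1r; apply: submodZ; first by apply: subN; rewrite ltnW.
  apply: submod_sum => [|i ii0]; first by apply: subN; rewrite ltnW.
  have [/existsP h|] := boolP [exists e, b (i, e) != 0].
    have ii : (i < i0)%N.
      by rewrite ltn_neqAle ii0 i0_max //; apply/existsP.
    apply: submodZ; first by apply: subN; rewrite ltnW.
    by apply: (strict_chain_mono chainN _ (vN i)); rewrite ii ltnW.
  rewrite negb_exists => /forallP h; rewrite /w big1 => [|e1 _].
    by rewrite normal_form_act0; apply: submod0; apply: subN; rewrite ltnW.
  by have /eqP -> := negbNE (h e1); rewrite scale0r.
rewrite -(leq_pmul2r (fact_gt0 m)) in card_le.
have := leq_trans card_le (card_mnm_lt_le _ _).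
rewrite [(d * k + _)%N]addnC addnA; apply: leq_trans.
by rewrite -mulnA leq_mul2l card_mnm_lt_ge orbT.
Qed.
End FilteredModule.

(** * From bounded chains to composition series *)

Lemma composition_series_strict_chain (K : fieldType) (A : algType K) (M : lmodType A)
  (l : nat) (N : nat -> {pred M}) : composition_series l N -> strict_chain l N.
Proof. by case=> _ _ subN covN; split=> // i /covN []. Qed.

(** In a chain from 0 to M of greatest length, no submodule fits strictly between consecutive terms:
    inserting it would lengthen the chain. *)
Lemma finite_length_bounded_chains (K : fieldType) (A : algType K) (M : lmodType A) (b : nat) :
  (forall l (N : nat -> {pred M}), strict_chain l N -> (l <= b)%N) -> finite_length M.
Proof.
move=> bounded.
pose full l := exists N : nat -> {pred M},
  [/\ N 0%N =i pred1 0, N l =i predT & strict_chain l N].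
have sub0 : GRing.submod_closed (pred1 (0 : M)).
  by split=> [|a x y]; rewrite ?inE // => /eqP -> /eqP ->; rewrite scaler0 addr0.
have subT : GRing.submod_closed (predT : {pred M}) by [].
have [l0 full0] : exists l, full l.
  have [[x x0]|nox] := pselect (exists x : M, x != 0); last first.
    exists 0%N, (fun=> predT : {pred M}); split=> // x; rewrite !inE.
    by apply/esym/negPn/negP => x0; apply: nox; exists x.
  exists 1%N, (fun i => if i is 0%N then pred1 0 : {pred M} else predT); split=> //.
  split=> [[]|[|i]] //; split=> // /(_ x isT); rewrite inE.
  by apply/negP.
have ex : exists l, `[< full l >] by exists l0; apply/asboolP.
have le_b l : `[< full l >] -> (l <= b)%N by move/asboolP => [N [_ _ /bounded]].
case: (ex_maxnP ex le_b) => l /asboolP [N [N0 NT chainN]] max_l.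
have [subN strictN] := chainN.
exists l, N; split=> // i il; have [sub_i nsub_i] := strictN i il; split=> // U subU iU Ui.
apply: contrapT => /not_orP [niU nUi].
have nUi' : ~ {subset U <= N i}.
  by move=> h; apply: niU => x; apply/idP/idP; [exact: h|exact: iU].
have niU' : ~ {subset N i.+1 <= U}.
  by move=> h; apply: nUi => x; apply/idP/idP; [exact: Ui|exact: h].
(* [U] is inserted at place i + 1 and the later terms move up by one. *)
pose N' j := if (j <= i)%N then N j else if j == i.+1 then U else N j.-1.
suff /max_l : `[< full l.+1 >] by rewrite ltnn.
apply/asboolP; exists N'; split.
- exact: N0.
- by rewrite /N' leqNgt ltnS (ltnW il) /= eqSS gtn_eqF.
split=> j jl; rewrite /N'.
  case: leqP => [ji|ij]; first by apply: subN; apply: leq_trans ji (ltnW il).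
  by case: eqP => // _; apply: subN; case: j jl ij.
have [ji|ij|ji] := ltngtP j i.
- by apply: strictN; apply: ltn_trans il.
- case: eqP => [->|ji]; first by rewrite (gtn_eqF (ltnSn _)).
  rewrite eqSS gtn_eqF //; case: j jl ij ji => // j jl _ _.
  exact: strictN.
by rewrite ji eqxx.
Qed.

(** * Stafford's argument for cyclicity *)

Section Cyclic.
Variables (K : fieldType) (m : nat) (A : algType K) (X D : 'I_m -> A).
Hypotheses (charK : [pchar K] =i pred0) (relXD : weyl_relations X D).
Variable M : lmodType A.
Local Notation nf := (normal_form X D).
Hypothesis annihilated : forall u : M, exists2 p, p != 0 & nf p *: u = 0.

(* Going down a composition series: if [u] generates [M] modulo [N (i + 1)] and
   no [u + x] generates [M] modulo [N i], then the annihilator of [u] maps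
   [N (i + 1)] into [N i], which weyl_act_notin forbids. *)
Lemma cyclic_of_composition_series l (N : nat -> {pred M}) :
  composition_series l N -> cyclic_module M.
Proof.
case=> N0 NT subN covN.
suff [u uP] : exists u : M, forall y, exists a : A, y - a *: u \in N 0%N.
  by exists u => y; have [a] := uP y; rewrite N0 inE subr_eq0 => /eqP ->; exists a.
suff : forall j, (j <= l)%N ->
    exists u : M, forall y, exists a : A, y - a *: u \in N (l - j)%N.
  by move/(_ l (leqnn l)); rewrite subnn.
elim=> [_|j IHj jl].
  by exists 0 => y; exists 0; rewrite subn0 NT.
have [u uP] := IHj (ltnW jl); have il : (l - j.+1 < l)%N by lia.
move: uP; have -> : (l - j)%N = (l - j.+1).+1 by lia.
move: (l - j.+1)%N il => i il uP.
have [iN nNi maxN] := covN i il; have subi := subN i (ltnW il); have subi1 := subN i.+1 il.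
apply: contrapT => nou.
have [p p0 pu] := annihilated u.
have pN x : x \in N i.+1 -> nf p *: x \in N i.
  (* [V] is the intersection of [N i.+1] with A (u + x) + [N i]; by maximality it is [N i] or
     [N i.+1]. *)
  move=> xN; pose V : {pred M} := fun y =>
    `[< y \in N i.+1 /\ exists a : A, y - a *: (u + x) \in N i >].
  have subV : GRing.submod_closed V.
    split=> [|a y z /asboolP [yN [b yb]] /asboolP [zN [c zc]]]; apply/asboolP.
      by split; [exact: submod0|exists 0; rewrite scale0r subr0; exact: submod0].
    split; first by case: subi1 => _; exact.
    exists (a * b + c); rewrite (_ : _ - _ = a *: (y - b *: (u + x)) + (z - c *: (u + x))).
      by case: subi => _; exact.
    by rewrite scalerBr scalerA scalerDl opprD addrACA.
  have iV : {subset N i <= V}.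
    by move=> y yi; apply/asboolP; split; [exact: iN|exists 0; rewrite scale0r subr0].
  have Vi : {subset V <= N i.+1} by move=> y /asboolP [].
  have [Veq|Veq] := maxN V subV iV Vi.
    (* If V = [N i]: p x = p (u + x), as p kills u. *)
    rewrite -Veq; apply/asboolP; split; first exact: submodZ.
    by exists (nf p); rewrite scalerDr pu add0r subrr; exact: submod0.
  have /asboolP [_ [a xa]] : x \in V by rewrite Veq.
  exfalso; apply: nou; exists (u + x) => y.
  have [b yb] := uP y.
  have /asboolP [_ [c yc]] : y - b *: u \in V by rewrite Veq.
  (* Modulo [N i], y = b u + c (u + x) and x = a (u + x), while b u = b (u + x) - b x. *)
  exists (b - b * a + c).
  rewrite (_ : y - _ = (y - b *: u - c *: (u + x)) - b *: (x - a *: (u + x))).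
    by apply: submodB => //; exact: submodZ.
  rewrite scalerBr scalerA -[X in _ = y - b *: X - _ - _](addrK x) scalerBr.
  rewrite scalerDl scalerBl [RHS]addrAC -[in RHS](addrA y) -opprD.
  by rewrite [in RHS]addrA subrK opprD addrA.
have [v [vN vN']] : exists v, v \in N i.+1 /\ v \notin N i.
  apply: contrapT => nov; apply: nNi => x xN; apply: contrapT => xi.
  by apply: nov; exists x; split=> //; apply/negP.
have [q _] := weyl_act_notin relXD charK subi vN' p0 (leqnSn _).
by case/negP; apply: pN; exact: submodZ.
Qed.
End Cyclic.

(** * Growth degree, spans and Gelfand-Kirillov dimension *)

(** For each e > 0 the constant C^k is at most i^e for large i, so the exponent k + e is admissible
    in the infimum. *)
Lemma growth_degree_le (R : realType) (f : nat -> nat) (C k : nat) :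
  (forall i, 0 < i -> f i <= (C * i) ^ k)%N -> (growth_degree R f <= (k%:R)%:E)%E.
Proof.
move=> fC; apply/lee_addgt0Pr => e e0; apply: ereal_inf_lbound.
exists (k%:R + e); last by rewrite EFinD.
pose B : R := (C%:R ^+ k) `^ e^-1.
have B0 : 0 <= B by exact: powR_ge0.
exists (Num.bound B) => i Bi.
have Bi' : B < i%:R by apply: lt_le_trans (archi_boundP B0) _; rewrite ler_nat.
have i0 : (0 < i)%N by rewrite -(ltr_nat R) (le_lt_trans B0).
have i0' : (i%:R : R) != 0 by rewrite pnatr_eq0 -lt0n.
rewrite powRD; last by rewrite i0' implybT.
rewrite powR_mulrn //; apply: le_trans (_ : ((C * i) ^ k)%:R <= _).
  by rewrite ler_nat fC.
rewrite natrX natrM exprMn mulrC ler_wpM2l ?exprn_ge0 //.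
have -> : C%:R ^+ k = B `^ e by rewrite /B -powRrM mulVf ?gt_eqF // powRr1 // exprn_ge0.
by rewrite ge0_ler_powR ?nnegrE // ltW.
Qed.

(** If r < k, then i^(k - r) exceeds B for large i, so r is not admissible. *)
Lemma growth_degree_ge (R : realType) (f : nat -> nat) (B k : nat) :
  (forall i, i ^ k <= B * f i)%N -> ((k%:R)%:E <= growth_degree R f)%E.
Proof.
move=> fB; apply: le_ereal_inf_tmp => _ [r [N fN] <-]; rewrite lee_fin leNgt; apply/negP => rk.
have e0 : 0 < k%:R - r by rewrite subr_gt0.
pose b : R := B%:R `^ (k%:R - r)^-1.
have b0 : 0 <= b by exact: powR_ge0.
pose i := (maxn N (Num.bound b)).
have bi : b < i%:R.
  by apply: lt_le_trans (archi_boundP b0) _; rewrite ler_nat leq_maxr.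
have i0 : 0 < (i%:R : R) by exact: le_lt_trans b0 bi.
have : (i%:R : R) ^+ k <= B%:R * i%:R `^ r.
  rewrite -natrX; apply: le_trans (_ : (B * f i)%:R <= _); first by rewrite ler_nat.
  by rewrite natrM; apply: ler_wpM2l => //; apply: fN; exact: leq_maxl.
apply/negP; rewrite -ltNge -powR_mulrn ?ler0n //.
rewrite -[k%:R](subrK r) powRD; last by apply/implyP => _; rewrite gt_eqF.
rewrite ltr_pM2r ?powR_gt0 //.
have -> : B%:R = b `^ (k%:R - r) by rewrite /b -powRrM mulVf ?gt_eqF // powRr1 // ler0n.
by rewrite gt0_ltr_powR // nnegrE // ltW.
Qed.

Section KSpan.
Variables (K : fieldType) (A : algType K) (M : lmodType A).
Implicit Types (s t b : seq M) (x y : M).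

Lemma kspan0 s : kspan s 0.
Proof. by exists (fun=> 0); rewrite /klincomb big1 // => i _; rewrite !scale0r. Qed.

Lemma kspanD s x y : kspan s x -> kspan s y -> kspan s (x + y).
Proof.
case=> c -> [d ->]; exists (fun i => c i + d i); rewrite /klincomb -big_split.
by apply: eq_bigr => i _ /=; rewrite !scalerDl.
Qed.

Lemma kspanZ s (a : K) x : kspan s x -> kspan s (a%:A *: x).
Proof.
case=> c ->; exists (fun i => a * c i); rewrite /klincomb scaler_sumr.
by apply: eq_bigr => i _; rewrite scalerA mulr_algl scalerA.
Qed.

Lemma kspan_sum s (I : Type) (r : seq I) (P : pred I) (F : I -> M) :
  (forall i, P i -> kspan s (F i)) -> kspan s (\sum_(i <- r | P i) F i).
Proof. by move=> sF; elim/big_ind: _ => //; [exact: kspan0|exact: kspanD]. Qed.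

Lemma kspan_mem s x : x \in s -> kspan s x.
Proof.
move=> xs; exists (fun i => (i == index x s)%:R); rewrite /klincomb.
have ix : (index x s < size s)%N by rewrite index_mem.
rewrite (bigD1 (Ordinal ix)) //= eqxx !scale1r nth_index // big1 ?addr0 // => i.
by rewrite -val_eqE /= => /negbTE ->; rewrite !scale0r.
Qed.

Lemma kspan_sub s t : {in t, forall x, kspan s x} -> (kspan t `<=` kspan s)%classic.
Proof.
move=> ts _ [c ->]; apply: kspan_sum => i _; apply: kspanZ.
by apply: ts; rewrite mem_nth.
Qed.

Lemma kspan_basis s : exists b, kfree b /\ kspan b = kspan s.
Proof.
have [k] := ubnP (size s); elim: k s => // k IHk s; rewrite ltnS => sk.
have [|nfree] := pselect (kfree s); first by exists s.
have [c [c0 [i [il ci]]]] : exists c : nat -> K,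
    klincomb c s = 0 /\ exists i, (i < size s)%N /\ c i != 0.
  apply: contrapT => noc; apply: nfree => c c0 i il; apply: contrapT => /eqP ci.
  by apply: noc; exists c; split => //; exists i.
pose t := [seq s`_j | j <- rem i (iota 0 (size s))].
have tE j : (j < size s)%N -> j != i -> s`_j \in t.
  by move=> js ji; apply: map_f; rewrite mem_rem_uniq ?iota_uniq // inE ji mem_iota.
have [|b [bfree bt]] := IHk t.
  rewrite size_map size_rem ?mem_iota // size_iota.
  by apply: leq_trans sk; rewrite prednK // (leq_ltn_trans _ il).
exists b; split => //; rewrite bt; apply/seteqP; split; apply: kspan_sub => x.
  move=> /mapP [j jr ->]; apply/kspan_mem/mem_nth.
  by move/mem_rem: jr; rewrite mem_iota.
move=> /(nthP 0) [j js <-]; have [->{j js}|ji] := eqVneq j i; last first.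
  by apply: kspan_mem; apply: tE.
have -> : s`_i = (- (c i)^-1)%:A *: \sum_(j < size s | j != Ordinal il) (c j)%:A *: s`_j.
  move: c0; rewrite /klincomb (bigD1 (Ordinal il)) //= => /eqP.
  rewrite addrC addr_eq0 => /eqP ->.
  by rewrite scalerN -scaleNr -scaleNr opprK scalerA mulr_algl scalerA mulVf // !scale1r.
apply/kspanZ/kspan_sum => j ji; apply/kspanZ/kspan_mem; apply: tE => //.
Qed.

(** By [kspan_basis] the choice in [kdim] is made from a nonempty set, so its value is the size of
    an actual basis. *)
Lemma kdim_basis s : exists b, [/\ size b = kdim (kspan s), kfree b & kspan b = kspan s].
Proof.
have [b [bfree bs]] := kspan_basis s.
have : exists k, [set k | exists b, [/\ size b = k, kfree b & kspan b = kspan s]]%classic k.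
  by exists (size b), b.
exact: xgetPex.
Qed.

Lemma kdim_ge s (I : finType) (F : I -> M) :
  (forall i, kspan s (F i)) ->
  (forall c : I -> K, \sum_i (c i)%:A *: F i = 0 -> forall i, c i = 0) ->
  (#|I| <= kdim (kspan s))%N.
Proof.
move=> sF Ffree; have [b [<- _ bs]] := kdim_basis s; rewrite leqNgt; apply/negP.
have bF i : kspan b (F i) by rewrite bs.
pose C i := sval (cid (bF i)).
have CE i : F i = klincomb (C i) b by exact: svalP (cid (bF i)).
rewrite -[size b]card_ord => /(linear_dependence (fun i (j : 'I_(size b)) => C i j)).
case=> c [i ci] cC; case/negP: ci; apply/eqP; apply: Ffree.
under eq_bigr => k _ do rewrite CE /klincomb scaler_sumr.
rewrite exchange_big big1 // => j _ /=.
under eq_bigr => k _ do rewrite scalerA mulr_algl scalerA.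
by rewrite -scaler_suml -scaler_suml cC !scale0r.
Qed.

Lemma mem_gen_filtrationS (a : seq A) s i c x :
  c \in a -> x \in gen_filtration a s i -> c *: x \in gen_filtration a s i.+1.
Proof. by move=> ca xs; rewrite mem_cat; apply/orP; right; exact: allpairs_f. Qed.

Lemma mem_gen_filtration (a : seq A) s i j x :
  (i <= j)%N -> x \in gen_filtration a s i -> x \in gen_filtration a s j.
Proof.
elim: j => [|j IHj]; first by rewrite leqn0 => /eqP ->.
by rewrite leq_eqVlt => /predU1P [-> //|/IHj h /h xs]; rewrite mem_cat xs.
Qed.
End KSpan.

Section GelfandKirillov.
Variables (R : realType) (K : fieldType) (m : nat) (A : algType K) (X D : 'I_m -> A).
Hypotheses (charK : [pchar K] =i pred0) (relXD : weyl_relations X D) (m_gt0 : (0 < m)%N).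
Variables (M : lmodType A) (phi : {additive M -> {mpoly K[m]}}).
Hypotheses (phi_inj : injective phi) (phiZ : forall (c : K) x, phi (c%:A *: x) = c *: phi x).
Hypothesis phi_act : forall a : A, exists c, forall x,
  (msize (phi (a *: x)) <= msize (phi x) + c)%N.
Variable v : M.
Hypothesis v_neq0 : v != 0.
Local Notation nf := (normal_form X D).
Local Notation sz x := (msize (phi x)).

Lemma kdim_le (s : seq M) N :
  {in s, forall x, sz x <= N.+1}%N -> (kdim (kspan s) <= #|{: 'X_{1..m < N.+1}}|)%N.
Proof.
move=> sN; have [b [<- bfree bs]] := kdim_basis s; rewrite leqNgt; apply/negP.
rewrite -[size b]card_ord.
move/(module_dependence phi_inj phiZ (F := fun i : 'I_(size b) => b`_i)).
case=> [i|c [i ci] c0].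
  have : kspan s b`_i by rewrite -bs; apply/kspan_mem/mem_nth.
  case=> c ->; rewrite /klincomb raddf_sum; apply: msize_sum_le => j _.
  by rewrite phiZ (leq_trans (msizeZ_le _ _)) // sN // mem_nth.
pose c' j := if insub j is Some k then c k else 0.
have c'E (j : 'I_(size b)) : c' j = c j by rewrite /c' valK.
case/negP: ci; apply/eqP; rewrite -c'E; apply: bfree => //.
by rewrite -[RHS]c0; apply: eq_bigr => j _; rewrite c'E.
Qed.

Lemma gen_filtration_size (a : seq A) (s : seq M) :
  exists c, forall i, {in gen_filtration a s i, forall x, sz x <= (c * i.+1).+1}%N.
Proof.
have [ca caP] : exists c, {in a, forall y x, sz (y *: x) <= sz x + c}%N.
  elim: a => [|y a [c cP]]; first by exists 0%N.
  have [c1 c1P] := phi_act y; exists (maxn c c1) => z; rewrite inE => /predU1P [->|za] x.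
    by apply: leq_trans (c1P x) _; rewrite leq_add2l leq_maxr.
  by apply: leq_trans (cP z za x) _; rewrite leq_add2l leq_maxl.
pose cs := (\max_(x <- s) sz x)%N; exists (ca + cs)%N; elim=> [|i IHi] x /=.
  move=> xs; rewrite muln1 leqW // (leq_trans _ (leq_addl _ _)) //.
  by rewrite /cs (big_rem x) //= leq_maxl.
rewrite mem_cat => /orP [/IHi h|].
  by apply: leq_trans h _; rewrite ltnS leq_mul2l leqnSn orbT.
case/allpairsP => -[y z] /= [ya /IHi h ->]; apply: leq_trans (caP y ya z) _.
by move: h; rewrite [((ca + cs) * i.+2)%N]mulnS; lia.
Qed.

Lemma gen_filtration_kdim_le (a : seq A) (s : seq M) :
  exists C, forall i, (0 < i)%N -> (kdim (kspan (gen_filtration a s i)) <= (C * i) ^ m)%N.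
Proof.
(* For positive i, m + c (i + 1) is at most (m + c + c) i. *)
have [c cP] := gen_filtration_size a s; exists (m + c + c)%N => i i0.
apply: leq_trans (kdim_le (cP i)) _.
apply: leq_trans (leq_pmulr _ (fact_gt0 m)) (leq_trans (card_mnm_lt_le _ _) _).
by rewrite leq_exp2r // mulnS !mulnDl !addnA leq_add2r leq_add ?leq_pmulr.
Qed.

Let gens := codom (weyl_gen X D).

Lemma monomial_mem_filtration e : nf 'X_[e] *: v \in gen_filtration gens [:: v] (mdeg e).
Proof.
rewrite normal_formX mdegE; elim: (index_enum _) => [|j s IHs].
  by rewrite !big_nil scale1r inE.
rewrite !big_cons; elim: (e j) => [|k IHk]; first by rewrite expr0 mul1r add0n.
rewrite exprS -mulrA -scalerA addSn; apply: mem_gen_filtrationS IHk.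
exact: codom_f.
Qed.

(** [free_embedding] with U = 0: monomials of degree at most i in m suitable generators send v to
    independent vectors. *)
Lemma gen_filtration_kdim_ge i :
  (#|{: 'X_{1..m < i.+1}}| <= kdim (kspan (gen_filtration gens [:: v] i)))%N.
Proof.
have sub0 : GRing.submod_closed (pred1 (0 : M)).
  by split=> [|a x y]; rewrite ?inE // => /eqP -> /eqP ->; rewrite scaler0 addr0.
have v0 : v \notin pred1 0 by rewrite inE.
have [f f_inj f_free] := free_embedding charK relXD sub0 m_gt0 v0.
apply: (kdim_ge (F := fun e : 'X_{1..m < i.+1} => nf 'X_[embed_mnm f e] *: v)) => [e|c c0].
  apply/kspan_mem/(mem_gen_filtration _ (monomial_mem_filtration _)).
  by rewrite mdeg_embed_mnm -ltnS bmdeg.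
apply: f_free; rewrite inE normal_form_act_sum; apply/eqP; rewrite -[RHS]c0.
by apply: eq_bigr => e _; rewrite normal_formC.
Qed.

(** Every filtration grows at most like i^m, and the one given by the generators and a single
    nonzero vector attains this. *)
Lemma gk_dimE : gk_dim M R = (m%:R)%:E.
Proof.
apply/eqP; rewrite eq_le; apply/andP; split.
  apply: ge_ereal_sup => _ [[a s] _ <-] /=.
  by have [C CP] := gen_filtration_kdim_le a s; exact: growth_degree_le CP.
apply: le_trans (ereal_sup_ubound _); last by exists (gens, [:: v]).
apply: (@growth_degree_ge R _ m`! m) => i.
by rewrite mulnC (leq_trans (card_mnm_lt_ge m i)) // leq_mul2r gen_filtration_kdim_ge orbT.
Qed.
End GelfandKirillov.

(** * The twisted module and its degree filtration *)

(** For the Gelfand-Kirillov dimension, which allows any finite set of operators and not only the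
    generators. *)
Lemma weyl_act_size (K : fieldType) (m : nat) (a : weyl K m) :
  exists c, forall p, (msize (a p) <= msize p + c)%N.
Proof.
elim/weyl_ind: a => [i|i||a b [ca ha] [cb hb]|c a [ca ha]|a b [ca ha] [cb hb]].
- exists 1%N => p; rewrite polyopE mulrC; apply: leq_trans (msize_mul_le _ _) _.
  by rewrite msizeX mdeg1.
- exists 0%N => p; rewrite partialE addn0; apply: leq_trans (msize_mderiv _ _) _.
  exact: leq_pred.
- by exists 0%N => p; rewrite weyl1E addn0.
- exists (maxn ca cb) => p; rewrite weylDE; apply: msize_add_le.
    by apply: leq_trans (ha p) _; rewrite leq_add2l leq_maxl.
  by apply: leq_trans (hb p) _; rewrite leq_add2l leq_maxr.
- by exists ca => p; rewrite weylZE; apply: leq_trans (msizeZ_le _ _) (ha p).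
exists (cb + ca)%N => p; rewrite weylME; apply: leq_trans (ha _) _.
by rewrite addnA leq_add2r.
Qed.

(** Each term is a product of first derivatives. The bound is coarse but equals the one for
    multiplication by f. *)
Lemma msize_poisson (K : fieldType) (n : nat) (f g : {mpoly K[n + n]}) :
  (msize (poisson f g) <= msize g + (msize f).-1)%N.
Proof.
have term i j : (msize (f^`M(i) * g^`M(j)) <= msize g + (msize f).-1)%N.
  apply: leq_trans (msize_mul_le _ _) _; rewrite addnC.
  apply: leq_add (msize_mderiv _ _); apply: leq_trans (leq_pred _) _.
  exact: leq_trans (msize_mderiv _ _) (leq_pred _).
by apply: msize_sum_le => i _; apply: msize_add_le; rewrite ?msizeN.
Qed.

Section TwistedModule.
Variables (K : fieldType) (charK : [pchar K] =i pred0) (n : nat).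
Variables (sigma : {lrmorphism {mpoly K[n + n]} -> {mpoly K[n + n]}}).
Hypothesis sigmaP : poisson_endo sigma.
Local Notation M := (twisted (weyl_ext charK sigmaP) (polymod K (n + n))).
Local Notation W := (weyl K (n + n)).

(** The identity, typed so as to serve as [phi]: twisting changes the action only. *)
Definition twisted_poly (x : M) : {mpoly K[n + n]} := x.
Fact twisted_poly_is_zmod_morphism : zmod_morphism twisted_poly.
Proof. by []. Qed.
HB.instance Definition _ := GRing.isZmodMorphism.Build M {mpoly K[n + n]} twisted_poly
  twisted_poly_is_zmod_morphism.

Lemma twisted_polyE (a : W) x :
  twisted_poly (a *: x) = weyl_ext charK sigmaP a (twisted_poly x).
Proof. by []. Qed.

Lemma twisted_polyZ (c : K) (x : M) : twisted_poly (c%:A *: x) = c *: twisted_poly x.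
Proof. by rewrite twisted_polyE linearZ rmorph1. Qed.

Lemma msize_sigma_le i : ((msize (sigma 'X_i)).-1 <= endo_deg sigma)%N.
Proof. exact: (leq_bigmax (F := fun i => (msize (sigma 'X_i)).-1)). Qed.

(** The variables act by multiplication by their images, the derivations by Poisson brackets with
    these images up to sign; both add at most the degree of sigma. *)
Lemma twisted_poly_gen (j : 'I_((n + n) + (n + n))) (x : M) :
  (msize (twisted_poly (weyl_gen (fun i => polyop 'X_i) (@partial K (n + n)) j *: x)) <=
   msize (twisted_poly x) + endo_deg sigma)%N.
Proof.
rewrite twisted_polyE /weyl_gen; case: (split j) => i.
  rewrite weyl_extX polyopE mulrC; apply: leq_trans (msize_mul_le _ _) _.
  by rewrite leq_add2l msize_sigma_le.
rewrite weyl_extD /ext_D; case: (split i) => a; rewrite hamiltonianE;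
  apply: leq_trans (msize_poisson _ _) _; rewrite leq_add2l ?msizeN //;
  exact: msize_sigma_le.
Qed.

Lemma twisted_poly_act (a : W) : exists c, forall x : M,
  (msize (twisted_poly (a *: x)) <= msize (twisted_poly x) + c)%N.
Proof. exact: weyl_act_size. Qed.
End TwistedModule.

Theorem theorem8 (R : realType) (K : fieldType) (charK : [pchar K] =i pred0)
    (n : nat) (n_gt0 : (0 < n)%N)
    (sigma : {lrmorphism {mpoly K[n + n]} -> {mpoly K[n + n]}})
    (sigmaP : poisson_endo sigma) :
  let M := twisted (weyl_ext charK sigmaP) (polymod K (n + n)) in
  [/\ holonomic R M, finite_length M, cyclic_module M
    & (module_length M <= endo_deg sigma ^ (2 * n))%N].
Proof.
move=> M; have m_gt0 : (0 < n + n)%N by rewrite addn_gt0 n_gt0.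
have relW := weyl_relationsW K (n + n).
pose phi : {additive M -> {mpoly K[n + n]}} := twisted_poly (sigmaP := sigmaP).
have phi_inj : injective phi by [].
have phiZ := @twisted_polyZ K charK n sigma sigmaP.
have phi_gen := @twisted_poly_gen K charK n sigma sigmaP.
have chain_le := strict_chain_length charK relW m_gt0 (phi := phi) phi_inj phiZ phi_gen.
have flM : finite_length M := finite_length_bounded_chains chain_le.
have cycM : cyclic_module M.
  have [l [N NP]] := flM.
  apply: (cyclic_of_composition_series charK relW _ NP) => u.
  exact: (exists_annihilator m_gt0 (phi := phi) phi_inj phiZ phi_gen).
split => //.
  split; last first.
    apply: (gk_dimE R charK relW m_gt0 (phi := phi) phi_inj phiZ _ (v := (1 : {mpoly _[_]}))).
      exact: twisted_poly_act.
    exact: oner_neq0.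
  have [u uP] := cycM; exists [:: u] => y; have [a ->] := uP y.
  by exists (fun=> a); rewrite big_ord1.
(* For the default value 0 of [xget] the bound is trivial; otherwise [l] is the length of a
   composition series. *)
rewrite mul2n -addnn /module_length; case: xgetP => // l _ [N NP].
exact: chain_le (composition_series_strict_chain NP).
Qed.
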